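(* The eigenvalues of the random transposition shuffle $\overline{\mathrm{RT}}_n$ on the hyperoctahedral group $B_n$ are indexed by bi-partitions $\overline\lambda=(\lambda^1,\lambda^2)\vdash n$. The eigenvalue corresponding to $\overline\lambda$ occurs with multiplicity $d_{\overline\lambda}^2$, and is given by $$\mathrm{eig}(\overline\lambda)=\frac1{2n^2}\Bigl(2|\lambda^1|+4\,\mathrm{Diag}(\lambda^1)+4\,\mathrm{Diag}(\lambda^2)\Bigr).$$ (If several bi-partitions give the same value, their multiplicities add.)
   Context: $B_n$ is the group (under composition) of all bijections $\sigma$ of $\{\pm1,\dots,\pm n\}$ with $\sigma(-i)=-\sigma(i)$; $S_n\subset B_n$ is the subgroup with $\sigma(i)>0$ for $i>0$. $\xi_i\in B_n$ swaps $i$ and $-i$ and fixes all $j\ne\pm i$. $\overline{\mathrm{RT}}_n$ is the random walk on $B_n$ driven by the distribution: $\overline{\mathrm{RT}}_n(e)=\frac1{2n}$; $\overline{\mathrm{RT}}_n(\xi_i)=\frac1{2n^2}$ for $1\le i\le n$; $\overline{\mathrm{RT}}_n((i\,j))=\overline{\mathrm{RT}}_n(\xi_i\xi_j(i\,j))=\frac1{n^2}$ for $1\le i<j\le n$; and $0$ elsewhere. Its eigenvalues are those of the transition matrix $P(g,h)=\overline{\mathrm{RT}}_n(hg^{-1})$, $g,h\in B_n$. A bi-partition $\overline\lambda=(\lambda^1,\lambda^2)$ of $n$ is a pair of (possibly empty) partitions with $|\lambda^1|+|\lambda^2|=n$. A standard Young (bi-)tableau of shape $\overline\lambda$ is a filling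 of the boxes of the two Young diagrams by $1,\dots,n$, each used exactly once, increasing along rows and down columns within each diagram; $d_{\overline\lambda}$ is the number of these, i.e. $d_{\overline\lambda}=\binom n{|\lambda^1|}d_{\lambda^1}d_{\lambda^2}$ with $d_\mu$ the number of standard Young tableaux of shape $\mu$. For a partition $\mu$, $\mathrm{Diag}(\mu)=\sum_{(i,j)\in\mu}(j-i)$, the sum over boxes in row $i$ and column $j$ of its Young diagram. *)

(* Defs.v *)
From HB Require Import structures.
From mathcomp Require Import all_boot all_order all_algebra all_fingroup.

Set Implicit Arguments.
Unset Strict Implicit.
Unset Printing Implicit Defensive.

Import Order.TTheory GRing.Theory Num.Theory.

Local Open Scope ring_scope.

(* {±1, ..., ±n}: (i, false) stands for i + 1 and (i, true) for -(i + 1). *)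
Definition signed n : finType := ('I_n * bool)%type.

Definition sopp n (x : signed n) : signed n := (x.1, ~~ x.2).

Definition hyperoct n : {set {perm signed n}} :=
  [set s : {perm signed n} | [forall x, s (sopp x) == sopp (s x)]].

Lemma hyperoct_group_set n : group_set (hyperoct n).
Proof.
apply/group_setP; split=> [|s t].
  by rewrite inE; apply/forallP=> x; rewrite !perm1.
rewrite !inE => /forallP s_opp /forallP t_opp; apply/forallP=> x.
by rewrite !permM (eqP (s_opp x)) (eqP (t_opp _)).
Qed.

Canonical hyperoct_group n := Group (hyperoct_group_set n).

(* The sign change of i. *)
Definition sflip n (i : 'I_n) : {perm signed n} := tperm (i, false) (i, true).

(* The element (i j) of S_n inside B_n: it also exchanges -i and -j. *)
Definition stransp n (i j : 'I_n) : {perm signed n} :=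
  (tperm (i, false) (j, false) * tperm (i, true) (j, true))%g.

(* The product of permutations in the library is (s * t) x = t (s x), hence
   composites are written here, and in [RTmx], from right to left. *)
Definition RT (R : numFieldType) n (s : {perm signed n}) : R :=
  if s == 1%g then (2 * n%:R)^-1
  else if [exists i : 'I_n, s == sflip i] then (2 * n%:R ^+ 2)^-1
  else if [exists i : 'I_n, exists j : 'I_n,
             (i < j)%N && ((s == stransp i j) ||
                           (s == stransp i j * sflip j * sflip i)%g)]
       then (n%:R ^+ 2)^-1
  else 0.

(* Rows and columns follow the library's enumeration of B_n; the entry at
   (g, h) is the mass of the composite of h after the inverse of g. *)
Definition RTmx (R : numFieldType) n : 'M[R]_#|hyperoct n| :=
  \matrix_(a, b) RT R ((enum_val a)^-1 * enum_val b)%g.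

Definition is_part (s : seq nat) : bool := sorted geq s && (0%N \notin s).

Definition is_bipart (n : nat) (l : seq nat * seq nat) : bool :=
  [&& is_part l.1, is_part l.2 & (sumn l.1 + sumn l.2 == n)%N].

Record bipart (n : nat) := Bipart {
  bipart_val :> seq nat * seq nat;
  bipart_valP : is_bipart n bipart_val
}.

HB.instance Definition _ n := [isSub for @bipart_val n].
HB.instance Definition _ n := [Countable of bipart n by <:].

Lemma part_size_le (s : seq nat) : is_part s -> (size s <= sumn s)%N.
Proof.
case/andP=> _; elim: s => //= x s IHs; rewrite inE negb_or => /andP[x0 /IHs].
by rewrite -addn1 addnC; apply: leq_add; rewrite lt0n eq_sym.
Qed.

Lemma leq_sumn (s : seq nat) x : x \in s -> (x <= sumn s)%N.
Proof.
elim: s => //= y s IHs; rewrite inE => /predU1P[->|/IHs le_xs].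
  exact: leq_addr.
exact: leq_trans le_xs (leq_addl _ _).
Qed.

Definition bseq_code n (s : seq nat) : n.-bseq 'I_n.+1 :=
  insub_bseq n (map inord s).

Lemma bseq_codeK n s : is_part s -> (sumn s <= n)%N ->
  map val (bseq_code n s) = s.
Proof.
move=> ps le_sn; rewrite /bseq_code /insub_bseq insubdK; last first.
  by rewrite -topredE /= size_map (leq_trans (part_size_le ps)).
rewrite -map_comp -[RHS]map_id; apply/eq_in_map=> x /leq_sumn le_xs /=.
by rewrite inordK // ltnS (leq_trans le_xs).
Qed.

Definition bipart_code n (l : bipart n) :
    (n.-bseq 'I_n.+1 * n.-bseq 'I_n.+1)%type :=
  (bseq_code n (val l).1, bseq_code n (val l).2).

Definition bipart_decode n (c : n.-bseq 'I_n.+1 * n.-bseq 'I_n.+1) :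
    option (bipart n) :=
  insub (map val c.1, map val c.2).

Lemma bipart_codeK n : pcancel (@bipart_code n) (@bipart_decode n).
Proof.
case=> -[s t] l_ok; case/and3P: (l_ok) => /= ps pt /eqP st.
rewrite /bipart_decode /bipart_code /= !bseq_codeK ?insubT //.
- by rewrite -st leq_addl.
- by rewrite -st leq_addr.
Qed.

HB.instance Definition _ n : isFinite (bipart n) :=
  PCanIsFinite (@bipart_codeK n).

(* Boxes as pairs (row, column), both numbered from 0. *)
Definition diagram (s : seq nat) : seq (nat * nat) :=
  [seq (i, j) | i <- iota 0 (size s), j <- iota 0 (nth 0%N s i)].

Definition Diag (s : seq nat) : int :=
  \sum_(b <- diagram s) (b.2%:Z - b.1%:Z).

Definition bidiagram (l : seq nat * seq nat) :
    seq ((nat * nat) + (nat * nat)) :=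
  map inl (diagram l.1) ++ map inr (diagram l.2).

(* c is to the right of b in the same row, or below b in the same column. *)
Definition box_lt (b c : nat * nat) : bool :=
  ((b.1 == c.1) && (b.2 < c.2)%N) || ((b.2 == c.2) && (b.1 < c.1)%N).

Definition bibox_lt (x y : (nat * nat) + (nat * nat)) : bool :=
  match x, y with
  | inl b, inl c => box_lt b c
  | inr b, inr c => box_lt b c
  | _, _ => false
  end.

(* The entry k of 'I_n stands for k + 1. *)
Definition is_standard (n : nat) (l : bipart n)
    (T : {ffun seq_sub (bidiagram l) -> 'I_n}) : bool :=
  [forall k, #|[set x | T x == k]| == 1%N] &&
  [forall x, forall y, bibox_lt (val x) (val y) ==> (T x < T y)%N].

Definition nb_standard (n : nat) (l : bipart n) : nat :=
  #|[set T | is_standard (l := l) T]|.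

Definition eig (R : numFieldType) (n : nat) (l : bipart n) : R :=
  (2 * n%:R ^+ 2)^-1 *
  (2 * (sumn l.1)%:R + 4 * (Diag l.1)%:~R + 4 * (Diag l.2)%:~R).

(* Main.v *)
(** Let B_n act on functions F on B_n by right and by left translation.  The
    sign changes xi_k and the Jucys-Murphy sums J_k of the (i k) and
    xi_i xi_k (i k), i < k, act by commuting operators, and RT_n is
    (1 / (2 n^2)) sum_k (1 + xi_k + 2 J_k).  For every pair (S, T) of standard
    tableaux of the same shape there is a nonzero F on which xi_k and J_k act
    from the left by the sign of the component and twice the content of the
    box of k in S, and from the right likewise with T.  When S and T are the
    row-reading tableau such an F is f^* * f, where f is a product of
    Vandermonde determinants in the places of the entries, which is an
    eigenvector of the J_k by Lagrange interpolation; the other pairs are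
    reached from this one by the intertwiners F(g s_k) - F(g) / (difference of
    contents).  These joint eigenvalues are pairwise distinct, so the F are
    linearly independent, and their number, the sum of the d^2, is
    2^n n! because the Young graph of pairs of diagrams satisfies
    D U - U D = 2.  Hence they form an eigenbasis. *)

Require Import Defs.
From mathcomp Require Import all_boot all_order all_algebra all_fingroup.
From mathcomp Require Import zify ring.

Set Implicit Arguments.
Unset Strict Implicit.
Unset Printing Implicit Defensive.

Import Order.TTheory GRing.Theory Num.Theory.
Local Open Scope ring_scope.

(** * Weights of functions on B_n and intertwiners *)

(** The walk multiplies on one side only, so its eigenvalue on F is read from T alone, and in fact
    from the shape, through the sum of the contents. The left tableau S separates eigenvectors: for
    each shape it provides d copies of each of the d right weights, whence the multiplicity d^2.
    Completeness is a squeeze between three inequalities. Independence of the F bounds the number of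
    pairs of tableaux by the order of B_n; recording the images of 1, ..., n bounds that order by
    2^n n!; counting paths in the Young graph bounds 2^n n! by the number of pairs. All three are
    then equalities, and neither a classification of irreducible representations nor an insertion
    algorithm enters. As R is any numeric field, the diagonalization rests on explicit functions
    with values in R. The delicate point is that they do not vanish: for the row-reading pair a sum
    of squares is positive, and for the intertwiners the contents of the two exchanged entries, when
    these share a component, differ by at least 2. *)

Lemma tperm_pairE (I : finType) (J : finType) (i j p : I) (b c : J) :
  tperm (i, b) (j, b) (p, c) = (if c == b then tperm i j p else p, c).
Proof.
have [->|cb] := eqVneq c b.
  have pinj : injective (fun x : I => (x, b)) by move=> x y [].
  by rewrite -(inj_tperm i j p pinj).
by rewrite tpermD // xpair_eqE [b == c]eq_sym (negbTE cb) andbF.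
Qed.

Lemma stranspE n (i j : 'I_n) x : stransp i j x = (tperm i j x.1, x.2).
Proof. by case: x => p [] /=; rewrite permM !tperm_pairE. Qed.

Lemma sflipE n (i : 'I_n) x : sflip i x = (x.1, x.2 (+) (x.1 == i)).
Proof.
rewrite /sflip; case: x => p [] /=; have [->|pi] := eqVneq p i;
  rewrite ?tpermL ?tpermR // tpermD // xpair_eqE ?andbF // andbT eq_sym //.
Qed.

Lemma stransp2 n (i j : 'I_n) : (stransp i j * stransp i j = 1)%g.
Proof. by apply/permP=> x; rewrite permM !stranspE /= tpermK perm1; case: x. Qed.

Lemma stranspV n (i j : 'I_n) : ((stransp i j)^-1 = stransp i j)%g.
Proof. by apply: (mulgI (stransp i j)); rewrite mulgV stransp2. Qed.

Lemma stranspC n (i j : 'I_n) : stransp i j = stransp j i.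
Proof. by apply/permP=> x; rewrite !stranspE tpermC. Qed.

Lemma stransp_hyperoct n (i j : 'I_n) : stransp i j \in hyperoct n.
Proof. by rewrite inE; apply/forallP=> x; rewrite /sopp !stranspE. Qed.

Lemma sflip_hyperoct n (i : 'I_n) : sflip i \in hyperoct n.
Proof. by rewrite inE; apply/forallP=> x; rewrite /sopp !sflipE /= addNb. Qed.

Lemma stransp_conj n (a b i j : 'I_n) :
  (stransp i j * stransp a b =
   stransp a b * stransp (tperm a b i) (tperm a b j))%g.
Proof.
apply/permP=> x; rewrite [LHS]permM [RHS]permM !stranspE /=.
by rewrite -(inj_tperm _ _ _ (@perm_inj _ (tperm a b))).
Qed.

Lemma sflip_conj n (a b i : 'I_n) :
  (sflip i * stransp a b = stransp a b * sflip (tperm a b i))%g.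
Proof.
apply/permP=> x; rewrite [LHS]permM [RHS]permM !(sflipE, stranspE) /=.
by rewrite (inj_eq perm_inj).
Qed.

Section Weights.
Variables (R : numFieldType) (n : nat) (X : finType) (eps : X -> bool).
Variable cont : X -> int.

(* The sum is half of J_k, k = T x: terms with y in the other component cancel,
   as (i k) and xi_i xi_k (i k) then contribute opposite values. *)
Definition rweight (T : X -> 'I_n) (F : {perm signed n} -> R) :=
  (forall g x, F (g * sflip (T x))%g = (-1) ^+ eps x * F g) /\
  (forall g x, \sum_(y | (T y < T x)%N && (eps y == eps x))
     F (g * stransp (T y) (T x))%g = (cont x)%:~R * F g).

Definition biweight (S T : X -> 'I_n) (F : {perm signed n} -> R) :=
  [/\ forall g, g \notin hyperoct n -> F g = 0,
      exists g, F g != 0,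
      rweight S (fun g => F g^-1%g) & rweight T F].

Lemma biweight_inv S T F :
  biweight S T F -> biweight T S (fun g => F g^-1%g).
Proof.
case=> F0 [g Fg] wS [wT1 wT2]; split=> //.
- by move=> h hG; apply: F0; rewrite groupV.
- by exists g^-1%g; rewrite invgK.
- split=> h x.
    by rewrite !invgK wT1.
  by rewrite !invgK -wT2; apply: eq_bigr=> y _; rewrite invgK.
Qed.

Definition swapf (T : X -> 'I_n) (a b : X) (x : X) : 'I_n :=
  tperm (T a) (T b) (T x).

(** Left and right translations commute, so an intertwiner built from right translates leaves the
    weight of S untouched. *)
Lemma rweight_shift S F s : 
  rweight S (fun g => F g^-1%g) -> rweight S (fun g => F (g^-1 * s)%g).
Proof.
have E h : (h^-1 * s = (s^-1 * h)^-1)%g by rewrite invMg invgK.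
move=> [w1 w2]; split=> g x /=.
  by rewrite !E mulgA w1.
rewrite E -w2.
by apply: eq_bigr=> y _; rewrite E mulgA.
Qed.

(** * Exchanging two consecutive entries *)

Section Swap.
Variables (T : X -> 'I_n) (a b : X).
Hypotheses (Tinj : injective T) (Tab : T b = (T a).+1 :> nat).

Let s := stransp (T a) (T b).

Lemma neq_ab : a != b.
Proof. by apply/eqP=> ab; move: Tab; rewrite ab; lia. Qed.

Lemma swapf_id x : x != a -> x != b -> swapf T a b x = T x.
Proof.
by move=> xa xb; rewrite /swapf tpermD // (inj_eq Tinj) eq_sym.
Qed.

Lemma swapf_lt x y : x != a -> x != b ->
  (swapf T a b y < swapf T a b x)%N = (T y < T x)%N.
Proof.
move=> xa xb; rewrite (swapf_id xa xb).
have xa' : T x != T a by rewrite (inj_eq Tinj).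
have xb' : T x != T b by rewrite (inj_eq Tinj).
have [->|ya] := eqVneq y a; first by rewrite /swapf tpermL; move: xa' xb';
  rewrite -!val_eqE /=; lia.
have [->|yb] := eqVneq y b; first by rewrite /swapf tpermR; move: xa' xb';
  rewrite -!val_eqE /=; lia.
by rewrite swapf_id.
Qed.

Lemma swap_sum_other (F : {perm signed n} -> R) g x :
  rweight T F -> x != a -> x != b ->
  \sum_(y | (swapf T a b y < swapf T a b x)%N && (eps y == eps x))
     F (g * stransp (swapf T a b y) (swapf T a b x) * s)%g
  = (cont x)%:~R * F (g * s)%g.
Proof.
move=> [_ w2] xa xb; rewrite -w2; apply: eq_big => y; first by rewrite swapf_lt.
by move=> _; rewrite /s -mulgA stransp_conj /swapf !tpermK mulgA.
Qed.

(** With k the entry of [a], this is the relation J_{k+1} s = s J_k + 1 (up to the factor 2):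
    conjugation by s carries the terms of J_k to those of J_{k+1}, except for y = b, whose term is s
    s = 1 and which is present only when [a] and [b] share a component. *)
Lemma swap_sum_a (F : {perm signed n} -> R) g :
  rweight T F ->
  \sum_(y | (swapf T a b y < swapf T a b a)%N && (eps y == eps a))
     F (g * stransp (swapf T a b y) (swapf T a b a) * s)%g
  = (cont a)%:~R * F (g * s)%g + (eps a == eps b)%:R * F g.
Proof.
move=> [_ w2]; rewrite -w2.
under eq_bigr do rewrite /s -mulgA stransp_conj /swapf !tpermK mulgA.
rewrite /swapf tpermL.
have E y : (tperm (T a) (T b) (T y) < T b)%N = (y == b) || (T y < T a)%N.
  have [->|ya] := eqVneq y a; first by rewrite tpermL (negbTE neq_ab); lia.
  have [->|yb] := eqVneq y b; first by rewrite tpermR; lia.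
  have: T y != T a by rewrite (inj_eq Tinj).
  rewrite -/(swapf T a b y) swapf_id //= -val_eqE /=; lia.
have [eab|nab] := eqVneq (eps a) (eps b); last first.
  rewrite mul0r addr0; apply: eq_bigl=> y; rewrite E.
  have [->|//] := eqVneq y b.
  by rewrite eq_sym (negbTE nab) !andbF.
rewrite mul1r (bigD1 b) ?E ?eqxx ?eab //= addrC; congr (_ + _).
  apply: eq_bigl=> y; rewrite E andbC andbA.
  have [->|//] := eqVneq y b; rewrite /= ?andbT //; first by symmetry;
    apply/negbTE; rewrite negb_and; apply/orP; left; lia.
by rewrite stranspC -mulgA stransp2 mulg1.
Qed.

Lemma swap_sum_b (F : {perm signed n} -> R) g :
  rweight T F ->
  \sum_(y | (swapf T a b y < swapf T a b b)%N && (eps y == eps b))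
     F (g * stransp (swapf T a b y) (swapf T a b b) * s)%g
  = (cont b)%:~R * F (g * s)%g - (eps a == eps b)%:R * F g.
Proof.
move=> [_ w2]; rewrite -w2.
under eq_bigr do rewrite /s -mulgA stransp_conj /swapf !tpermK mulgA.
rewrite /swapf tpermR.
have E y : (tperm (T a) (T b) (T y) < T a)%N = (y != a) && (T y < T b)%N.
  have [->|ya] := eqVneq y a; first by rewrite tpermL; lia.
  have [->|yb] := eqVneq y b; first by rewrite tpermR; lia.
  have: T y != T a by rewrite (inj_eq Tinj).
  rewrite -/(swapf T a b y) swapf_id //= -val_eqE /=; lia.
have [eab|nab] := eqVneq (eps a) (eps b); last first.
  rewrite mul0r subr0; apply: eq_bigl=> y; rewrite E.
  have [->|//] := eqVneq y a.
  by rewrite (negbTE nab) !andbF.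
rewrite mul1r [X in _ = X - _](bigD1 a) /= ?eab ?eqxx ?andbT ?Tab //.
rewrite -mulgA stransp2 mulg1 addrAC subrr add0r.
by apply: eq_bigl=> y; rewrite E Tab -andbA andbC.
Qed.

Lemma biweight_swap S F :
    (eps a = eps b -> cont b - cont a \notin [:: 0; 1; -1]) ->
    biweight S T F ->
  exists F', biweight S (swapf T a b) F'.
Proof.
move=> gap; case=> F0 [g0 Fg0] wS wT.
have sG : s \in hyperoct n by apply: stransp_hyperoct.
have ss : (s * s = 1)%g by apply: stransp2.
(* This value absorbs the extra terms F g and - F g of [swap_sum_a] and [swap_sum_b]: it solves al *
   (cont b - cont a) = 1. In different components there is no extra term, and translation by s alone
   exchanges the weights. *)
pose al : R := if eps a == eps b then ((cont b - cont a)%:~R)^-1 else 0.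
exists (fun g => F (g * s)%g - al * F g); split.
- move=> g gG; rewrite !F0 ?mulr0 ?subr0 //.
  by apply: contra gG => gsG; rewrite -(mulgK s g) groupM ?groupV.
(* If the new function vanished at both g0 and g0 * s, then F g0 = al^2 F g0, which is impossible as
   [al] is neither 1 nor -1. *)
- case: (eqVneq (F (g0 * s)%g - al * F g0) 0) => [E1|]; last by exists g0.
  case: (eqVneq (F g0 - al * F (g0 * s)%g) 0) => [E2|]; last first.
    by exists (g0 * s)%g; rewrite -mulgA ss mulg1.
  case/negP: Fg0; move: E1 E2; rewrite /al.
  case: eqP => [/gap gp|_]; last by rewrite !mul0r !subr0 => _ /eqP.
  set c := cont b - cont a in gp *.
  move: gp; rewrite !inE !negb_or => /and3P[c0 c1 c2].
  have cR0 : (c%:~R : R) != 0 by rewrite intr_eq0.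
  have cR : (c%:~R : R) ^+ 2 - 1 != 0.
    rewrite subr_sqr_1 mulf_neq0 //.
      by rewrite subr_eq0 -[1]/(1%:~R) eqr_int.
    by rewrite addr_eq0 -[1]/(1%:~R) -rmorphN eqr_int.
  move=> /eqP; rewrite subr_eq0 => /eqP ->; move=> H.
  have : (c%:~R ^+ 2 - 1) * F g0 = 0.
    by rewrite -(mulr0 (c%:~R ^+ 2)) -H; field.
  by move/eqP; rewrite mulf_eq0 (negbTE cR).
- have [u1 u2] := rweight_shift s wS.
  have [v1 v2] := wS.
  split=> g x.
    by rewrite u1 v1 mulrBr mulrCA.
  rewrite sumrB u2 -mulr_sumr v2; ring.
have [w1 w2] := wT.
split=> g x.
  rewrite /= -mulgA sflip_conj /swapf tpermK mulgA !w1.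
  rewrite -/(swapf T a b x) mulrBr; congr (_ - _); rewrite [RHS]mulrCA.
  have [xa|xa] := eqVneq x a.
    by rewrite xa /swapf tpermL w1 /al;
      have [->//|_] := eqVneq (eps a) (eps b); rewrite !mul0r.
  have [xb|xb] := eqVneq x b.
    by rewrite xb /swapf tpermR w1 /al;
      have [->//|_] := eqVneq (eps a) (eps b); rewrite !mul0r.
  by rewrite swapf_id // w1.
rewrite sumrB -mulr_sumr.
(* Within one component, [swapf T a b] is T composed with the exchange of the boxes [a] and [b], so
   the untranslated F is still an eigenvector of the sums, with the contents of [a] and [b]
   exchanged. *)
have Fsum : (eps a == eps b) -> \sum_(y | (swapf T a b y < swapf T a b x)%N &&
  (eps y == eps x))
     F (g * stransp (swapf T a b y) (swapf T a b x))%g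
       = (cont (tperm a b x))%:~R * F g.
  move=> /eqP eab.
  have epsE y : eps (tperm a b y) = eps y by case: tpermP => // ->.
  rewrite -w2 (reindex_inj (@perm_inj _ (tperm a b))).
  by apply: eq_big=> y; rewrite /swapf !(inj_tperm _ _ _ Tinj) !tpermK ?epsE.
rewrite /al; have [eab|nab] := eqVneq (eps a) (eps b); last first.
  rewrite !mul0r !subr0.
  have [->|xa] := eqVneq x a.
    by rewrite swap_sum_a // (negbTE nab) mul0r addr0.
  have [->|xb] := eqVneq x b.
    by rewrite swap_sum_b // (negbTE nab) mul0r subr0.
  by rewrite swap_sum_other.
rewrite Fsum ?eab //.
have d0 : (cont b)%:~R - (cont a)%:~R != 0 :> R.
  by have := gap eab; rewrite -rmorphB /= intr_eq0 inE negb_or => /andP[].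
rewrite rmorphB /=.
have [->|xa] := eqVneq x a.
  by rewrite swap_sum_a // tpermL eab eqxx mulr1n; field.
have [->|xb] := eqVneq x b.
  by rewrite swap_sum_b // tpermR eab eqxx mulr1n; field.
by rewrite swap_sum_other // tpermD 1?eq_sym //; ring.
Qed.
End Swap.
End Weights.

(** * The row-reading eigenvector *)

Lemma lagrange_interpolation (F : fieldType) (I : finType) (A : pred I)
    (Y : I -> F) (p : {poly F}) (z : F) :
    injective Y -> (size p <= #|A|)%N ->
  \sum_(i | A i) p.[Y i] * \prod_(l | A l && (l != i)) ((z - Y l) / (Y i - Y l))
  = p.[z].
Proof.
move=> Yinj szp.
pose L i : {poly F} := \prod_(l | A l &&
  (l != i)) ((Y i - Y l)^-1 *: ('X - (Y l)%:P)).
have LE i x : (L i).[x] = \prod_(l | A l && (l != i)) ((x - Y l) / (Y i - Y l)).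
  by rewrite horner_prod; apply: eq_bigr=> l _; rewrite !hornerE mulrC.
have szL i : A i -> (size (L i) <= #|A|)%N.
  move=> Ai; apply: leq_trans (size_prod_leq _ _) _.
  pose P : pred I := fun l => A l && (l != i).
  rewrite -/P; have cA : #|A| = #|P|.+1 by rewrite (cardD1x Ai).
  have szP : (\sum_(l | A l &&
    (l != i)) size ((Y i - Y l)^-1 *: ('X - (Y l)%:P)) <= #|P| * 2)%N.
    apply: leq_trans (_ : _ <= \sum_(l | A l && (l != i)) 2)%N _;
      last by rewrite sum_nat_const.
    by apply: leq_sum => l _;
      rewrite (leq_trans (size_scale_leq _ _)) // size_XsubC.
  by rewrite cA leq_subLR addnS ltnS addnn -muln2.
have node i : A i -> (\sum_(j | A j) p.[Y j] *: L j).[Y i] = p.[Y i].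
  move=> Ai; rewrite horner_sum (bigD1 i) //= [X in _ + X]big1 ?addr0.
    rewrite hornerZ LE big1 ?mulr1 // => l /andP[_ li].
    by rewrite divff // subr_eq0 (inj_eq Yinj) eq_sym.
  move=> j /andP[Aj ji]; rewrite hornerZ LE (bigD1 i) ?Ai 1?eq_sym //=.
  by rewrite subrr !mul0r mulr0.
suff pE : p = \sum_(i | A i) p.[Y i] *: L i.
  rewrite [RHS](congr1 (fun r : {poly F} => r.[z]) pE) horner_sum.
  by apply: eq_bigr=> i Ai; rewrite hornerZ LE.
apply/eqP; rewrite -subr_eq0; apply/eqP.
apply: (@roots_geq_poly_eq0 _ _ [seq Y i | i <- enum A]).
- apply/allP=> y /mapP[i]; rewrite mem_enum => Ai ->.
  by rewrite /root hornerD hornerN node // subrr.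
- by rewrite (map_inj_uniq Yinj) enum_uniq.
rewrite size_map -cardE.
apply: leq_trans (size_polyD _ _) _; rewrite geq_max szp size_polyN.
apply: (leq_trans (size_sum _ _ _)); apply/bigmax_leqP=> i Ai.
exact: leq_trans (size_scale_leq _ _) (szL i Ai).
Qed.

(** * Vandermonde products over the blocks of a partition *)

Section Vandermonde.
Variables (F : fieldType) (X : finType) (K : eqType) (T : X -> nat) (rho : X ->
  K).
Hypothesis Tinj : injective T.

(** One Vandermonde determinant for each fibre of [rho]; T merely orders the fibre and so fixes the
    sign. *)
Definition vdm (Q : pred X) (Y : X -> F) : F :=
  \prod_(x | Q x) \prod_(y | [&& Q y, (T x < T y)%N & rho x == rho y]) (Y y - Y
    x).

Lemma vdm_neq0 Q Y : injective Y -> vdm Q Y != 0.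
Proof.
move=> Yinj; apply/prodf_neq0=> x _; apply/prodf_neq0=> y /and3P[_ xy _].
by rewrite subr_eq0 (inj_eq Yinj); apply: contraTneq xy => ->; rewrite ltnn.
Qed.

Lemma eq_vdm (Q : pred X) Y Y' : (forall x, Q x -> Y x = Y' x) -> vdm Q Y
    = vdm Q Y'.
Proof.
move=> YY; apply: eq_bigr=> x Qx; apply: eq_bigr=> y /and3P[Qy _ _].
by rewrite !YY.
Qed.

(** The sign that arises when every factor containing [b] is turned into the form Y b - Y m. *)
Definition vdm_sign (Q : pred X) b : F :=
  \prod_(m | [&& Q m, m != b & rho m == rho b]) (if (T m < T b)%N then 1 else -1).

Lemma vdm_split (Q : pred X) b Y : Q b ->
  vdm Q Y = vdm_sign Q b * \prod_(m | [&& Q m, m != b & rho m == rho b]) (Y b -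
    Y m)
    * vdm [pred x | Q x && (x != b)] Y.
Proof.
move=> Qb; rewrite /vdm_sign -big_split /= {1}/vdm (bigD1 b) //=.
rewrite [X in _ * X](_ : _ = \prod_(x | Q x && (x != b))
   ((if (T x < T b)%N && (rho x == rho b) then Y b - Y x else 1) *
    \prod_(y | [&& Q y && (y != b), (T x < T y)%N & rho x == rho y]) (Y y - Y
      x))).
  rewrite big_split /= mulrA; congr (_ * _).
  rewrite [LHS]mulrC big_mkcond /= [X
    in _ * X]big_mkcond /= -big_split [RHS]big_mkcond /=.
  apply: eq_bigr=> m _.
  have [->|mb] := eqVneq m b; first by rewrite ltnn /= !andbF mulr1.
  case: (Q m) => //=; rewrite ?mulr1 // [rho b == _]eq_sym.
  have [_|_] := eqVneq (rho m) (rho b); rewrite ?andbF ?andbT ?mulr1 //.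
  have [H|H|H] := ltngtP (T m) (T b); rewrite ?mulr1 ?mul1r ?mulN1r ?opprB //.
  by move/Tinj/eqP: H; rewrite (negbTE mb).
apply: eq_bigr=> x /andP[Qx xb].
case: ifP => [H|H].
  rewrite (bigD1 b) ?Qb //=; congr (_ * _); apply: eq_bigl=> y.
  by case: (y == b); rewrite ?andbF ?andbT.
rewrite mul1r; apply: eq_bigl=> y.
by have [->|] := eqVneq y b; rewrite ?andbT //= H !andbF.
Qed.

(** One constant C serves all Y' that agree with Y away from [a] and [b]. Comparing Y with
    [Y \o tperm a b] therefore involves only the factors containing [a] or [b], and the signs hidden
    in C are never computed. *)
Lemma vdm_pair a b Y : a != b -> exists C : F, forall Y',
  (forall m, m != a -> m != b -> Y' m = Y m) ->
  vdm predT Y' = C * (if rho a == rho b then Y' b - Y' a else 1) *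
    \prod_(m | [&& m != a, m != b & rho m == rho b]) (Y' b - Y m) *
    \prod_(m | [&& m != a, m != b & rho m == rho a]) (Y' a - Y m).
Proof.
move=> ab.
exists (vdm_sign predT b * vdm_sign (predC1 b) a * vdm [pred x | (x != b) &&
  (x != a)] Y) => Y' YY.
rewrite (@vdm_split predT b) //= (@vdm_split _ a) /=; last by rewrite ab.
rewrite (@eq_vdm _ Y' Y); last by move=> x /= /andP[xb xa]; apply: YY.
rewrite [X in _ * X * _](_ : _ = (if rho a == rho b then Y' b - Y' a else 1) *
    \prod_(m | [&& m != a, m != b & rho m == rho b]) (Y' b - Y m)); last first.
  case: ifP => rab.
    rewrite (bigD1 a) ?ab //=; congr (_ * _); apply: eq_big=> m.
      by case: (m == a); rewrite ?andbF ?andbT.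
    by move=> /andP[/andP[mb _] ma]; rewrite (YY m).
  rewrite mul1r; apply: eq_big=> m.
    by have [->|//] := eqVneq m a; rewrite rab andbF.
  move=> /andP[mb rm]; rewrite (YY m) //.
  by apply: contraTneq rm => ->; rewrite rab.
rewrite [\prod_(m | [&& m != b, m != a & _]) _](_ : _
  = \prod_(m | [&& m != a, m != b & rho m == rho a]) (Y' a - Y m)).
  by rewrite /=; ring.
apply: eq_big=> m; first by rewrite /= !andbA [(m != a) && _]andbC.
by case/and3P=> mb ma _; rewrite (YY m).
Qed.

Lemma vdm_swap_same a b Y : a != b -> rho a = rho b ->
  vdm predT (Y \o tperm a b) = - vdm predT Y.
Proof.
move=> ab rab; have [C vE] := vdm_pair Y ab.
rewrite !vE //; last by move=> m ma mb /=; rewrite tpermD // eq_sym.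
rewrite rab eqxx /= tpermL tpermR; ring.
Qed.

(* Dividing by [vdm predT Y], the sum is Lagrange's interpolation formula at
   [Y b], with nodes the values on the row [r], for the polynomial vanishing
   at the other values on the row of [b]. *)
Lemma vdm_garnir r b Y : injective Y -> r != rho b ->
    (#|[pred x | rho x == rho b]| <= #|[pred x | rho x == r]|)%N ->
  \sum_(a | rho a == r) vdm predT (Y \o tperm a b) = vdm predT Y.
Proof.
move=> Yinj rb le_rows.
pose p : {poly F} := \prod_(m | (m != b) && (rho m == rho b)) ('X - (Y m)%:P).
have pE x : p.[x] = \prod_(m | (m != b) && (rho m == rho b)) (x - Y m).
  by rewrite horner_prod; apply: eq_bigr=> m _; rewrite !hornerE.
have szp : (size p <= #|[pred x | rho x == r]|)%N.
  apply: leq_trans le_rows; rewrite (cardD1x (eqxx (rho b))) add1n.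
  have -> : p = \prod_(m <- enum [pred m | (m != b) &&
    (rho m == rho b)]) ('X - (Y m)%:P).
    by rewrite big_enum.
  rewrite size_prod_XsubC -cardE ltnS; apply/subset_leq_card/subsetP=> m.
  by rewrite !inE andbC.
have Yneq m m' : m != m' -> Y m - Y m' != 0 by rewrite subr_eq0 (inj_eq Yinj).
have pb0 : p.[Y b] != 0.
  by rewrite pE; apply/prodf_neq0=> m /andP[mb _]; rewrite Yneq 1?eq_sym.
rewrite -[RHS]mulr1 -(divff pb0) mulrA [RHS]mulrAC.
rewrite -[X in _ * X](lagrange_interpolation (Y b) Yinj szp) mulr_sumr.
apply: eq_big=> // a /eqP ra.
have ab : a != b by apply: contraNneq rb => <-; rewrite -ra.
have [C vE] := vdm_pair Y ab.
rewrite !vE //; last by move=> m ma mb /=; rewrite tpermD // eq_sym.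
rewrite ra (negbTE rb) /= tpermL tpermR !pE prodf_div !mulr1.
have rowb m : [&& m != a, m != b & rho m == rho b] = (m != b) && (rho m == rho b).
  by have [->|//] := eqVneq m a; rewrite ra (negbTE rb) andbF.
have rowa m : [&& m != a, m != b & rho m == r] = (rho m == r) && (m != a).
  have [->|_] := eqVneq m b;
    first by rewrite [rho b == r]eq_sym (negbTE rb) /= !andbF.
  by rewrite [RHS]andbC.
rewrite !(eq_bigl _ _ rowb) !(eq_bigl _ _ rowa).
have q0 : \prod_(m | (rho m == r) && (m != a)) (Y a - Y m) != 0.
  by apply/prodf_neq0=> m /andP[_ ma]; rewrite Yneq 1?eq_sym.
by move: pb0; rewrite pE => pb0; field; rewrite q0 pb0.
Qed.

End Vandermonde.

Lemma hyperoct_sopp n (h : {perm signed n}) x :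
  h \in hyperoct n -> h (sopp x) = sopp (h x).
Proof. by rewrite inE => /forallP/(_ x)/eqP. Qed.

(** * The eigenvector attached to a row-reading filling *)

Section RowReading.
Variables (R : numFieldType) (n : nat) (X : finType) (eps : X -> bool).
Variables (row col : X -> nat) (T : X -> 'I_n).
Hypothesis Tinj : injective T.
Hypothesis T_lt : forall x y, eps x = eps y ->
  (T y < T x)%N = (row y < row x)%N || ((row y == row x) && (col y < col x)%N).
Hypothesis col_card : forall x,
  #|[pred y | [&& eps y == eps x, row y == row x & (col y < col x)%N]]| = col x.
Hypothesis row_card : forall x r, (r < row x)%N ->
  (#|[pred y | (eps y == eps x) && (row y == row x)]| <=
   #|[pred y | (eps y == eps x) && (row y == r)]|)%N.

Let cont x : int := (col x)%:Z - (row x)%:Z.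
Let rho x := (eps x, row x).

(** Here h sends places to entries, and right multiplication acts on entries; the place of the entry
    of x is thus an inverse image. *)
Definition place (h : {perm signed n}) (x : X) : signed n :=
  (h^-1)%g (T x, false).

Lemma place_stransp h a b x :
  place (h * stransp (T a) (T b)) x = place h (tperm a b x).
Proof. by rewrite /place invMg permM stranspV stranspE /= (inj_tperm _ _ _
  Tinj). Qed.

Lemma place_sflip h a x : h \in hyperoct n ->
  place (h * sflip (T a)) x = ((place h x).1, (place h x).2 (+) (x == a)).
Proof.
move=> hG; rewrite /place invMg permM tpermV -/(sflip (T a)) sflipE /=.
rewrite (inj_eq Tinj); have [xa|xa] := eqVneq x a; last first.
  by rewrite addbF; case: (_ (T x, false)).
by rewrite -[(T x, true)]/(sopp (T x, false)) hyperoct_sopp ?groupV //= addbT.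
Qed.

(** The row Vandermonde alone is antisymmetric along rows and would yield the opposite contents. The
    Vandermonde of all the places changes sign under every transposition of entries and corrects
    this. The last factor is the character of the sign changes of the entries in the component where
    [eps] holds. *)
Definition rowf (h : {perm signed n}) : R :=
  let Y x : R := (place h x).1%:R in
  if h \in hyperoct n then
    vdm T (fun _ => tt) predT Y * vdm T rho predT Y
      * \prod_x (-1) ^+ (eps x && (place h x).2)
  else 0.

Lemma place_inj h : h \in hyperoct n ->
    injective (fun x => ((place h x).1%:R : R)).
Proof.
move=> hG x y /eqP; rewrite eqr_nat => /eqP/val_inj xy.
have [/perm_inj [] /Tinj //|xy2] := eqVneq (place h x) (place h y).
have : place h x = sopp (place h y).
  move: xy xy2; case: (place h x) (place h y) => [p c] [q d] /= -> /=.
  by rewrite xpair_eqE eqxx /=; case: c d => [] [].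
by rewrite -hyperoct_sopp ?groupV // => /perm_inj [].
Qed.

Lemma rowf_neq0 h : h \in hyperoct n -> rowf h != 0.
Proof.
move=> hG; rewrite /rowf hG !mulf_neq0 ?vdm_neq0 //; try exact: place_inj.
by apply/prodf_neq0=> x _; rewrite signr_eq0.
Qed.

(** In a general [numFieldType] a square may fail to be nonnegative; real values make the sum of
    squares in [biweight_row] positive. *)
Lemma rowf_real h : rowf h \is Num.real.
Proof.
rewrite /rowf; case: ifP => // _; rewrite !rpredM //.
- by apply: rpred_prod=> x _; apply: rpred_prod=> y _; rewrite rpredB ?realn.
- by apply: rpred_prod=> x _; apply: rpred_prod=> y _; rewrite rpredB ?realn.
by apply: rpred_prod=> x _; rewrite rpredX // rpredN rpred1.
Qed.

Lemma rowf_sflip h a : rowf (h * sflip (T a)) = (-1) ^+ eps a * rowf h.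
Proof.
rewrite /rowf groupMr ?sflip_hyperoct //; case: ifP => hG; last by rewrite mulr0.
rewrite [RHS]mulrCA; congr (_ * _ * _).
- by apply: eq_bigr=> x _; apply: eq_bigr=> y _; rewrite !place_sflip.
- by apply: eq_bigr=> x _; apply: eq_bigr=> y _; rewrite !place_sflip.
rewrite (bigD1 a) //= [in RHS](bigD1 a) //= mulrA; congr (_ * _).
  by rewrite place_sflip //= eqxx addbT; case: (eps a); case: (place h a).2;
    rewrite /= ?mulN1r ?mul1r ?opprK.
by apply: eq_bigr=> x xa; rewrite place_sflip //= (negbTE xa) addbF.
Qed.

Lemma rowf_stransp h a b : h \in hyperoct n -> a != b -> eps a = eps b ->
  let Y x : R := (place h x).1%:R in
  rowf (h * stransp (T a) (T b)) =
  - (vdm T (fun _ => tt) predT Y * vdm T rho predT (Y \o tperm a b)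
       * \prod_x (-1) ^+ (eps x && (place h x).2)).
Proof.
move=> hG ab eab Y; rewrite /rowf groupMr ?stransp_hyperoct // hG.
rewrite -!mulNr -(vdm_swap_same _ _ ab) //; last by move=> x y /val_inj/Tinj.
congr (_ * _ * _).
- by apply: eq_bigr=> x _; apply: eq_bigr=> y _; rewrite !place_stransp.
- by apply: eq_bigr=> x _; apply: eq_bigr=> y _; rewrite !place_stransp.
rewrite (reindex_inj (@perm_inj _ (tperm a b))) /=.
apply: eq_bigr=> x _; rewrite place_stransp tpermK.
by case: tpermP => // ->; rewrite eab.
Qed.

(** The content appears as column minus row. A box to the left in the row of x contributes [rowf h],
    the two Vandermonde signs cancelling, and there are [col x] of them. Row reading places every
    higher row entirely before x, so the remaining sum splits into complete rows; each contributes
    [- rowf h], by [vdm_garnir] and the sign of the full Vandermonde. *)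
Lemma rowf_jm h x :
  \sum_(y | (T y < T x)%N && (eps y == eps x)) rowf (h * stransp (T y) (T x))%g
  = (cont x)%:~R * rowf h.
Proof.
have Tn : injective (fun x => T x : nat) by move=> u v /val_inj/Tinj.
have [hG|hG] := boolP (h \in hyperoct n); last first.
  rewrite big1 /rowf ?(negbTE hG) ?mulr0 // => y _.
  by rewrite groupMr ?stransp_hyperoct // (negbTE hG).
rewrite (bigID (fun y => row y == row x)) /= /cont rmorphB /= mulrBl;
  congr (_ + _).
  rewrite (eq_bigr (fun _ => rowf h)); last first.
    move=> y /andP[/andP[yx /eqP eyx] /eqP ryx].
    have nyx : y != x by apply: contraTneq yx => ->; rewrite ltnn.
    rewrite rowf_stransp // vdm_swap_same //; last by rewrite /rho eyx ryx.
    by rewrite /rowf hG; ring.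
  rewrite sumr_const -pmulrn mulr_natl; congr (_ *+ _).
  rewrite -[RHS]col_card; apply: eq_card=> y; rewrite inE unfold_in /=.
  have [eyx|] := eqVneq (eps y) (eps x); last by rewrite !andbF.
  rewrite andbT T_lt //=.
  by have [->|_] := eqVneq (row y) (row x); rewrite ?andbF // ltnn andbT.
transitivity (\sum_(r < row x) \sum_(y | rho y == (eps x, r : nat))
   rowf (h * stransp (T y) (T x))%g).
  rewrite [RHS](exchange_big_dep (fun y => (eps y == eps x) &&
    (row y < row x)%N)) /=; last first.
    by move=> r y _ /eqP[-> ->]; rewrite eqxx ltn_ord.
  apply: eq_big => y.
    have [eyx|] := eqVneq (eps y) (eps x); last by rewrite !andbF.
    rewrite andbT T_lt //=.
    by rewrite ltn_neqAle; case: (eqVneq (row y) (row x));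
      rewrite ?andbF ?andbT //= orbF.
  move=> /andP[/andP[yx /eqP eyx] ryx].
  have ltr : (row y < row x)%N by move: yx; rewrite T_lt // (negbTE ryx) orbF.
  rewrite (big_pred1 (Ordinal ltr)) // => r.
  by rewrite /rho /= xpair_eqE eyx eqxx -val_eqE /= eq_sym.
rewrite (eq_bigr (fun _ => - rowf h)).
  by rewrite sumr_const card_ord -pmulrn mulr_natl mulNrn.
move=> r _.
have rx : (eps x, r : nat) != rho x.
  by rewrite xpair_eqE eqxx /= neq_ltn ltn_ord.
pose Y x : R := (place h x).1%:R.
rewrite [in RHS]/rowf hG -/Y.
rewrite -[in RHS](vdm_garnir (T := T) Tn (place_inj hG) rx); last first.
  apply: leq_trans (leq_trans (row_card (ltn_ord r)) _);
    by rewrite subset_leq_card //; apply/subsetP=> y; rewrite !inE xpair_eqE.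
rewrite mulr_sumr mulr_suml -sumrN; apply: eq_bigr=> y /eqP[eyx ryx].
rewrite rowf_stransp //; apply: contraTneq (ltn_ord r) => yx.
by rewrite -ryx yx ltnn.
Qed.

Definition biweightf (g : {perm signed n}) : R :=
  \sum_(h in hyperoct n) rowf h * rowf (h * g).

Lemma biweightf_out g : g \notin hyperoct n -> biweightf g = 0.
Proof.
by move=> gG; apply: big1=> h hG;
  rewrite [rowf (h * g)]/rowf groupMl // (negbTE gG) mulr0.
Qed.

(** Invariance under inversion turns the right weight of the convolution into its left weight. *)
Lemma biweightfV g : biweightf g^-1 = biweightf g.
Proof.
have [gG|gG] := boolP (g \in hyperoct n); last by rewrite !biweightf_out ?groupV.
rewrite /biweightf (reindex_inj (mulIg g)) /=; apply: eq_big => h.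
  by rewrite groupMr.
by move=> _; rewrite mulgK mulrC.
Qed.

Lemma biweight_row : exists F : {perm signed n} -> R, biweight eps cont T T F.
Proof.
have w : rweight eps cont T biweightf.
  split=> g x.
    rewrite mulr_sumr; apply: eq_bigr=> h _.
    by rewrite mulgA rowf_sflip mulrCA.
  rewrite exchange_big /= mulr_sumr; apply: eq_bigr=> h _.
  by rewrite -mulr_sumr mulrCA -rowf_jm; under eq_bigr do rewrite mulgA.
exists biweightf; split=> //.
- exact: biweightf_out.
- exists 1%g; rewrite /biweightf (bigD1 1%g) ?group1 //= mulg1.
  rewrite lt0r_neq0 // ltr_wpDr //.
    apply: sumr_ge0=> h _; rewrite mulg1 -expr2 -realEsqr; exact: rowf_real.
  by rewrite lt_neqAle -expr2 -realEsqr rowf_real andbT eq_sym expf_neq0 //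
    rowf_neq0.
by split=> g x; rewrite ?biweightfV -?(proj1 w) -?(proj2 w) ?biweightfV //;
  apply: eq_bigr=> y _; rewrite biweightfV.
Qed.
End RowReading.

(** * Standard bi-tableaux *)

Notation boxes l := (seq_sub (bidiagram l)).

Definition tagbox (e : bool) (b : nat * nat) : (nat * nat) + (nat * nat) :=
  if e then inr b else inl b.

Definition box_comp (x : (nat * nat) + (nat * nat)) : bool :=
  if x is inr _ then true else false.

Definition box_pos (x : (nat * nat) + (nat * nat)) : nat * nat :=
  match x with inl b => b | inr b => b end.

Definition box_cont (x : (nat * nat) + (nat * nat)) : int :=
  (box_pos x).2%:Z - (box_pos x).1%:Z.

Definition rowlen (l : seq nat * seq nat) (e : bool) (i : nat) : nat :=
  nth 0%N (if e then l.2 else l.1) i.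

Lemma tagboxK x : tagbox (box_comp x) (box_pos x) = x.
Proof. by case: x. Qed.

Lemma bibox_ltE x y :
  bibox_lt x y = (box_comp x == box_comp y) && box_lt (box_pos x) (box_pos y).
Proof. by case: x y => [b|b] [c|c]. Qed.

Lemma mem_diagram s b : (b \in diagram s) = (b.2 < nth 0 s b.1)%N.
Proof.
apply/allpairsPdep/idP => [[i [j [+ + ->]]]|lt_b].
  by rewrite !mem_iota.
exists b.1, b.2; rewrite !mem_iota !add0n lt_b; split=> //;
  last by case: b {lt_b}.
by rewrite leq0n /= ltnNge; apply: contraTN lt_b => ?; rewrite nth_default.
Qed.

Lemma mem_bidiagram l e b : (tagbox e b \in bidiagram l)
    = (b.2 < rowlen l e b.1)%N.
Proof.
have inl_inj : injective (@inl (nat * nat) (nat * nat)) by move=> ? ? [].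
have inr_inj : injective (@inr (nat * nat) (nat * nat)) by move=> ? ? [].
rewrite mem_cat; case: e => /=.
  rewrite (mem_map inr_inj) mem_diagram; case: mapP => [[]//|_ /=]; by [].
rewrite (mem_map inl_inj) mem_diagram orbC; case: mapP => [[]//|_ /=]; by [].
Qed.

Lemma uniq_diagram s : uniq (diagram s).
Proof.
apply: allpairs_uniq_dep; first exact: iota_uniq.
  by move=> i _; apply: iota_uniq.
by move=> [i j] [i' j'] _ _ /= [-> ->].
Qed.

Lemma uniq_bidiagram l : uniq (bidiagram l).
Proof.
rewrite cat_uniq !map_inj_uniq ?uniq_diagram /= ?andbT; try by move=> ? ? [].
by apply/hasP=> -[_ /mapP[b _ ->]] /mapP[].
Qed.

Lemma size_diagram s : size (diagram s) = sumn s.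
Proof.
rewrite size_allpairs_dep; congr sumn.
apply: (@eq_from_nth _ 0%N); first by rewrite size_map size_iota.
move=> i; rewrite size_map size_iota => lt_i.
by rewrite (nth_map 0%N) ?size_iota // nth_iota.
Qed.

Lemma card_seq_sub_mem (I : choiceType) (s L : seq I) : uniq L ->
    {subset L <= s} ->
  #|[pred x : seq_sub s | val x \in L]| = size L.
Proof.
move=> uL sL; rewrite cardE -(size_map val); apply/perm_size/uniq_perm => //.
  by rewrite (map_inj_uniq val_inj) enum_uniq.
move=> x; apply/mapP/idP => [[y]|xL]; first by rewrite mem_enum inE => ? ->.
by exists (SeqSub (sL x xL)); rewrite ?mem_enum ?inE.
Qed.

Section Bipart.
Variables (n : nat) (l : bipart n).
Let X : finType := boxes l.

Lemma card_boxes : #|X| = n.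
Proof.
rewrite card_seq_sub ?uniq_bidiagram // size_cat !size_map !size_diagram.
by case: l => s /= /and3P[_ _ /eqP].
Qed.

Lemma rowlen_noninc e i j : (i <= j)%N -> (rowlen l e j <= rowlen l e i)%N.
Proof.
move=> ij; rewrite /rowlen.
have : sorted geq (if e then (val l).2 else (val l).1).
  by case: l => s /= /and3P[/andP[? _] /andP[? _] _]; case: e.
move: (if e then _ else _) => s ss.
have [js|/(nth_default 0%N) -> //] := ltnP j (size s).
by apply: (sorted_leq_nth _ _ _ ss) => //;
   rewrite ?inE ?(leq_ltn_trans ij) //; [move=> ? ? ? /= H K;
     exact: leq_trans K H|move=> ? /=].
Qed.

Lemma box_in (x : X) : ((box_pos (val x)).2 < rowlen l (box_comp (val x))
    (box_pos (val x)).1)%N.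
Proof. by rewrite -mem_bidiagram tagboxK; apply: valP. Qed.

Lemma box_ex e b : (b.2 < rowlen l e b.1)%N -> exists x : X, val x = tagbox e b.
Proof. by rewrite -mem_bidiagram => bl; exists (SeqSub bl). Qed.

Definition lexbox (x y : (nat * nat) + (nat * nat)) : bool :=
  (box_comp x < box_comp y)%N || (box_comp x == box_comp y) &&
  (((box_pos x).1 < (box_pos y).1)%N ||
   ((box_pos x).1 == (box_pos y).1) && ((box_pos x).2 < (box_pos y).2)%N).

Lemma lexbox_trans : transitive lexbox.
Proof.
move=> [[i j]|[i j]] [[i1 j1]|[i1 j1]] [[i2 j2]|[i2 j2]]; rewrite /lexbox //=;
  lia.
Qed.

Lemma lexbox_total x y : x != y -> lexbox x y || lexbox y x.
Proof.
case: x y => [[i j]|[i j]] [[i1 j1]|[i1 j1]] //= xy;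
  have: (i, j) != (i1, j1) by apply: contraNneq xy => ->.
all: rewrite xpair_eqE /lexbox /=; lia.
Qed.

Definition lexrank (x : X) : nat := #|[pred y : X | lexbox (val y) (val x)]|.

Lemma lexbox_irr x : lexbox x x = false.
Proof. by rewrite /lexbox !ltnn !andbF. Qed.

Lemma lexrank_lt x : (lexrank x < n)%N.
Proof.
rewrite -[X in (_ < X)%N]card_boxes; apply: proper_card.
by apply/properP; split; [apply/subsetP|exists x; rewrite // inE lexbox_irr].
Qed.

Lemma lexrank_mono x y : lexbox (val x) (val y) -> (lexrank x < lexrank y)%N.
Proof.
move=> xy; apply: proper_card; apply/properP; split.
  by apply/subsetP=> z; rewrite !inE => /lexbox_trans; apply.
by exists x; rewrite !inE ?lexbox_irr.
Qed.

Definition lextab (x : X) : 'I_n := Ordinal (lexrank_lt x).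

Lemma lextab_inj : injective lextab.
Proof.
move=> x y xy; apply/val_inj/eqP/idPn=> /lexbox_total/orP[] /lexrank_mono;
  by move/(congr1 val): xy => /= ->; rewrite ltnn.
Qed.

Lemma lextab_lt x y : (lextab x < lextab y)%N = lexbox (val x) (val y).
Proof.
have [/lexrank_mono -> //|nxy] := boolP (lexbox (val x) (val y)).
have [->|xy] := eqVneq x y; first by rewrite ltnn.
have := @lexbox_total (val x) (val y); rewrite (inj_eq val_inj) xy (negbTE nxy).
by move=> /(_ isT)/lexrank_mono /= yx; apply/negbTE; rewrite -leqNgt ltnW.
Qed.

(** There are n boxes, so an injective filling uses each entry exactly once. *)
Definition standard (T : X -> 'I_n) :=
  injective T /\ forall x y, bibox_lt (val x) (val y) -> (T x < T y)%N.

Lemma lextab_std : standard lextab.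
Proof.
split=> [|x y]; first exact: lextab_inj.
rewrite lextab_lt bibox_ltE /lexbox /box_lt => /andP[/eqP -> ].
rewrite ltnn eqxx /=; lia.
Qed.

Variable R : numFieldType.

Definition biweight_of (S T : X -> 'I_n) :=
  exists F : {perm signed n} -> R,
    biweight (fun x => box_comp (val x)) (fun x => box_cont (val x)) S T F.

Lemma biweight_lextab : biweight_of lextab lextab.
Proof.
apply: biweight_row; first exact: lextab_inj.
- move=> x y exy; rewrite lextab_lt /lexbox exy ltnn eqxx //=.
- move=> x; rewrite -[RHS](size_iota 0).
  pose f j := tagbox (box_comp (val x)) ((box_pos (val x)).1, j).
  have finj : injective f by rewrite /f /tagbox => j j'; case: ifP => _ [].
  rewrite -(size_map f) -(@card_seq_sub_mem _ (bidiagram l)).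
  - apply: eq_card=> y; rewrite !inE; apply/and3P/mapP.
      case=> /eqP e /eqP r lt_c; exists (box_pos (val y)).2;
        first by rewrite mem_iota.
      by rewrite /f -e -r -surjective_pairing tagboxK.
    case=> j; rewrite mem_iota add0n /= => lt_j; rewrite /f /tagbox => ->.
    by case: (box_comp (val x)); rewrite /= ?eqxx.
  - by rewrite map_inj_uniq ?iota_uniq.
  move=> _ /mapP[j + ->]; rewrite mem_iota add0n => /= lt_j.
  by rewrite mem_bidiagram /= (ltn_trans lt_j) ?box_in.
- move=> x r lt_r.
  have row_size i : #|[pred y : X | (box_comp (val y) == box_comp (val x)) &&
    ((box_pos (val y)).1 == i)]| = rowlen l (box_comp (val x)) i.
    rewrite -[RHS](size_iota 0).
    pose f j := tagbox (box_comp (val x)) (i, j).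
    have finj : injective f by rewrite /f /tagbox => j j'; case: ifP => _ [].
    rewrite -(size_map f) -(@card_seq_sub_mem _ (bidiagram l)).
    - apply: eq_card=> y; rewrite !inE; apply/andP/mapP.
        case=> /eqP e /eqP r'; exists (box_pos (val y)).2.
          by rewrite mem_iota /= -e -r' box_in.
        by rewrite /f -e -r' -surjective_pairing tagboxK.
      case=> j; rewrite mem_iota add0n /= => lt_j; rewrite /f /tagbox => ->.
      by case: (box_comp (val x)); rewrite /= ?eqxx.
    - by rewrite map_inj_uniq ?iota_uniq.
    move=> _ /mapP[j + ->]; rewrite mem_iota add0n => /= lt_j.
    by rewrite mem_bidiagram.
  by rewrite !row_size rowlen_noninc // ltnW.
Qed.

Lemma standard_surj T k : standard T -> exists x, T x = k.
Proof.
case=> Tinj _; have cX : (#|'I_n| <= #|X|)%N by rewrite card_boxes card_ord.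
by have /codomP[x ->] := inj_card_onto Tinj cX k; exists x.
Qed.

(** The path goes along the row of x to the column of y, then down that column; the corner is a box
    because higher rows are at least as long. *)
Lemma rowlen_anti T x y : standard T -> box_comp (val x) = box_comp (val y) ->
  ((box_pos (val x)).1 <= (box_pos (val y)).1)%N ->
  ((box_pos (val x)).2 <= (box_pos (val y)).2)%N -> (T x <= T y)%N.
Proof.
case=> Tinj Tlt exy le1 le2.
have [z zE] : exists z : X, val z
  = tagbox (box_comp (val y)) ((box_pos (val x)).1, (box_pos (val y)).2).
  by apply: box_ex => /=; apply: leq_trans (box_in y) (rowlen_noninc _ le1).
have cz : box_comp (val z) = box_comp (val y) by rewrite zE /tagbox; case: ifP.
have pz : box_pos (val z)
  = ((box_pos (val x)).1, (box_pos (val y)).2) by rewrite zE /tagbox; case: ifP.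
have xz : (T x <= T z)%N.
  have [e2|n2] := eqVneq (box_pos (val x)).2 (box_pos (val y)).2.
    suff -> : x = z by [].
    by apply: val_inj; rewrite zE -e2 -exy -surjective_pairing tagboxK.
  by rewrite ltnW // Tlt // bibox_ltE cz exy eqxx /box_lt pz /= eqxx /=
    ltn_neqAle n2 le2.
apply: leq_trans xz _.
have [e1|n1] := eqVneq (box_pos (val x)).1 (box_pos (val y)).1.
  suff -> : z = y by [].
  by apply: val_inj; rewrite zE e1 -surjective_pairing tagboxK.
by rewrite ltnW // Tlt // bibox_ltE cz eqxx /box_lt pz /= eqxx /= (ltn_neqAle _
  (box_pos (val y)).1) n1 le1 orbT.
Qed.

(** Consecutive entries of one component that are not neighbours in order can only lie strictly
    north-east or south-west of each other, and either position moves the content by at least 2. *)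
Lemma standard_gap T a b : standard T -> T b = (T a).+1 :> nat ->
  ~~ bibox_lt (val a) (val b) -> box_comp (val a) = box_comp (val b) ->
  box_cont (val b) - box_cont (val a) \notin [:: 0; 1; -1].
Proof.
move=> Tstd Tab nlt eab; have [Tinj Tlt] := Tstd.
have nlt' : ~~ bibox_lt (val b) (val a).
  by apply/negP=> /Tlt; rewrite Tab; lia.
have nab : val a != val b.
  by rewrite (inj_eq val_inj); apply/eqP=> ab; move: Tab; rewrite ab; lia.
have le_ba : ~~ (((box_pos (val b)).1 <= (box_pos (val a)).1)%N &&
  ((box_pos (val b)).2 <= (box_pos (val a)).2)%N).
  by apply/negP=> /andP[h1 h2]; have := rowlen_anti Tstd (esym eab) h1 h2; lia.
(* A corner strictly between [a] and [b] would need an entry between two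
   consecutive ones. *)
have le_ab : ((box_pos (val a)).1 < (box_pos (val b)).1)%N ->
  ((box_pos (val a)).2 < (box_pos (val b)).2)%N -> False.
  move=> h1 h2.
  have [z zE] : exists z : X, val z
    = tagbox (box_comp (val b)) ((box_pos (val a)).1, (box_pos (val b)).2).
    by apply: box_ex => /=; apply: leq_trans (box_in b) (rowlen_noninc _ (ltnW
      h1)).
  have cz : box_comp (val z) = box_comp (val b) by rewrite zE /tagbox; case: ifP.
  have pz : box_pos (val z)
    = ((box_pos (val a)).1, (box_pos (val b)).2) by rewrite zE /tagbox; case: ifP.
  have az : (T a < T z)%N by apply: Tlt;
    rewrite bibox_ltE cz eab eqxx /box_lt pz /= eqxx h2.
  have zb : (T z < T b)%N by apply: Tlt;
    rewrite bibox_ltE cz eqxx /box_lt pz /= eqxx h1 orbT.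
  by rewrite Tab ltnS leqNgt az in zb.
have {}nab : box_pos (val a) != box_pos (val b).
  by apply: contraNneq nab => pab;
    rewrite -[val a]tagboxK -[val b]tagboxK eab pab.
have {}le_ab : ~~ (((box_pos (val a)).1 < (box_pos (val b)).1)%N &&
  ((box_pos (val a)).2 < (box_pos (val b)).2)%N).
  by apply/negP=> /andP[/le_ab H /H].
move: nlt nlt' le_ba le_ab nab; rewrite !bibox_ltE eab eqxx /= /box_lt /box_cont.
case: (box_pos (val a)) (box_pos (val b)) => [i j] [i' j'] /=.
rewrite xpair_eqE !inE; lia.
Qed.

Lemma swapf_std T a b : standard T -> T b = (T a).+1 :> nat ->
  ~~ bibox_lt (val a) (val b) -> standard (swapf T a b).
Proof.
move=> [Tinj Tlt] Tab nab; split=> [x y /perm_inj/Tinj //|x y lt_xy].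
have := Tlt _ _ lt_xy; have ab := neq_ab Tab.
have Tneq z w : z != w -> (T z : nat) != T w by rewrite val_eqE (inj_eq Tinj).
have [xa|xa] := eqVneq x a; have [yb|yb] := eqVneq y b.
- by rewrite xa yb (negbTE nab) in lt_xy.
- rewrite xa; have [->|ya] := eqVneq y a; first by rewrite ltnn.
  rewrite (swapf_id Tinj ya yb) /swapf tpermL Tab; move: (Tneq _ _ yb);
    rewrite Tab; lia.
- rewrite yb; have [->|xb] := eqVneq x b; first by rewrite ltnn.
  rewrite (swapf_id Tinj xa xb) /swapf tpermR Tab; move: (Tneq _ _ xa); lia.
have [xb|xb] := eqVneq x b; have [ya|ya] := eqVneq y a.
- by rewrite xb ya Tab; lia.
- rewrite xb (swapf_id Tinj ya yb) /swapf tpermR Tab; lia.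
- rewrite ya (swapf_id Tinj xa xb) /swapf tpermL Tab; lia.
- by rewrite !swapf_id.
Qed.

Lemma sum_standard T : standard T -> (\sum_x T x = \sum_(k < n) k)%N.
Proof.
case=> Tinj _; rewrite [RHS](reindex T) //; apply: onW_bij.
by apply: inj_card_bij => //; rewrite card_boxes card_ord.
Qed.

(** Ascent along the successive entries of T gives T x <= T' x by induction on T x, and both
    fillings have the same sum of entries. *)
Lemma eq_standard T T' : standard T -> standard T' ->
    (forall a b, T b = (T a).+1 :> nat -> (T' a < T' b)%N) -> T =1 T'.
Proof.
move=> Tstd T'std asc.
have le_T k : forall x, T x = k :> nat -> (k <= T' x)%N.
  elim: k => // k IH x Tx; have lt_kn : (k < n)%N by rewrite ltnW // -Tx.
  have [y Ty] := standard_surj (Ordinal lt_kn) Tstd.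
  have Tyk : T y = k :> nat by rewrite Ty.
  by apply: leq_ltn_trans (IH y Tyk) _; apply: asc; rewrite Tx Tyk.
have [_] := leqif_sum (fun x (_ : true) => leqif_eq (le_T _ x erefl)).
rewrite !sum_standard // eqxx => /esym/forallP eqT x.
by apply/val_inj/eqP/eqT.
Qed.

Lemma eq_biweight_of S T T' : T =1 T' -> biweight_of S T -> biweight_of S T'.
Proof.
move=> TT' [F [F0 F1 wS [w1 w2]]]; exists F; split=> //; split=> g x.
  by rewrite -TT' w1.
by rewrite -w2; apply: eq_big => y; rewrite !TT'.
Qed.

(* Exchanging consecutive entries that are in the wrong order with respect to
   [lextab] leads from any standard tableau to [lextab]. *)
Lemma biweight_ofP S T : standard S -> standard T -> biweight_of S T.
Proof.
have sym S' T' : biweight_of S' T' -> biweight_of T' S'.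
  by case=> F /biweight_inv; eexists; eassumption.
(* Only right tableaux are ever moved: from the pair ([lextab], [lextab]) to ([lextab], S), by
   inversion to (S, [lextab]), then to (S, T). *)
suff H S' : forall T', standard T' -> biweight_of S' lextab -> biweight_of S' T'.
  move=> Sstd Tstd; apply: (H _ _ Tstd); apply: sym; apply: (H _ _ Sstd).
  exact: biweight_lextab.
(* Rearrangement supplies the measure: putting the larger entry on the box that is later in [lextab]
   lowers this sum by the difference of the two values of [lextab]. *)
move=> T'; have [k] := ubnP (\sum_x lextab x * (n - T' x))%N.
elim: k T' => // k IH T' lt_k Tstd wS.
have [Tinj Tlt] := Tstd; have [lexinj lexlt] := lextab_std.
have [/existsP[a /existsP[b /andP[/eqP Tab lt_ba]]]|noinv] :=
  boolP [exists a, exists b, ((T' b : nat) == (T' a).+1) &&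
    (lextab b < lextab a)%N]; last first.
  apply: (eq_biweight_of (T := lextab)) => // x; symmetry; move: x.
  apply: eq_standard => // a b Tab.
  rewrite ltnNge leq_eqVlt val_eqE (inj_eq lexinj) negb_or eq_sym (neq_ab Tab) /=.
  move/existsPn/(_ a)/existsPn/(_ b): noinv; by rewrite Tab eqxx.
have nlt_ab : ~~ bibox_lt (val a) (val b) by apply/negP=> /lexlt;
  rewrite ltnNge ltnW.
have ab := neq_ab Tab.
have T2std := swapf_std Tstd Tab nlt_ab.
have Eb : swapf T' a b b = T' a by rewrite /swapf tpermR.
have Ea : swapf T' a b a = T' b by rewrite /swapf tpermL.
have /IH /(_ T2std wS) [F wF] : (\sum_x lextab x * (n - swapf T' a b x) < k)%N.
  rewrite ltnS in lt_k; apply: leq_trans _ lt_k.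
  rewrite (bigD1 a) // [X in (_ < X)%N](bigD1 a) //=.
  rewrite (bigD1 b) 1?eq_sym // [X in (_ < _ + X)%N](bigD1 b) 1?eq_sym //= Ea Eb.
  rewrite (eq_bigr (fun x => lextab x * (n - T' x)))%N; last first.
    by move=> x /andP[xa xb]; rewrite swapf_id.
  rewrite !addnA ltn_add2r Tab; have := ltn_ord (T' b); rewrite Tab => lt_n.
  have -> : (n - T' a = (n - (T' a).+1).+1)%N by lia.
  rewrite !mulnS; move: lt_ba => /=; move: (_ * _)%N (_ * _)%N; lia.
(* The induction hypothesis concerns the exchanged tableau, so the intertwiner runs backwards, from
   it to T', with the roles of [a] and [b] reversed. *)
have Tba : swapf T' a b a = (swapf T' a b b).+1 :> nat by rewrite Ea Eb.
have [T2inj _] := T2std.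
have gap (e : box_comp (val b) = box_comp (val a)) :
   box_cont (val a) - box_cont (val b) \notin [:: 0; 1; -1].
  have := standard_gap Tstd Tab nlt_ab (esym e).
  rewrite !inE; lia.
have := biweight_swap T2inj Tba gap wF.
by apply: eq_biweight_of => x; rewrite {1}/swapf Ea Eb /swapf tpermC tpermK.
Qed.

End Bipart.

Lemma part_inj s t : is_part s -> is_part t -> nth 0%N s =1 nth 0%N t -> s = t.
Proof.
have le_size s' t' : is_part s' -> nth 0%N s' =1 nth 0%N t' ->
  (size s' <= size t')%N.
  case/andP=> _ s0 st; rewrite leqNgt; apply: contra s0 => lt_ts.
  by rewrite -(nth_default 0%N (leqnn (size t'))) -st mem_nth.
move=> ps pt st; apply: (@eq_from_nth _ 0%N) => [|i _]; last exact: st.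
by apply/eqP; rewrite eqn_leq !le_size // => i; rewrite st.
Qed.

Lemma bipart_inj n (l l' : bipart n) : bidiagram l =i bidiagram l' -> l = l'.
Proof.
move=> ll'.
have E e i : rowlen l e i = rowlen l' e i.
  have lt_len j : (j < rowlen l e i)%N = (j < rowlen l' e i)%N.
    by rewrite -(mem_bidiagram l e (i, j)) -(mem_bidiagram l' e (i, j)) ll'.
  apply/eqP; rewrite eqn_leq; apply/andP; split; rewrite leqNgt; apply/negP.
    by rewrite lt_len ltnn.
  by rewrite -lt_len ltnn.
apply: val_inj; move: E; rewrite /rowlen.
case: l l' {ll'} => [[s1 s2] /= /and3P[ps1 ps2 _]] [[t1 t2] /= /and3P[pt1 pt2
  _]] E.
by congr (_, _); apply: part_inj => // i; [apply: (E false)|apply: (E true)].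
Qed.

(* The next box of a diagonal to be filled is determined by those already
   filled, so contents and components of the entries determine the tableau. *)
Lemma standard_determined n (l l' : bipart n) (T : boxes l ->
    'I_n) (T' : boxes l' -> 'I_n) :
    standard T -> standard T' ->
    (forall x x', T x = T' x' -> box_comp (val x) = box_comp (val x') /\
                                 box_cont (val x) = box_cont (val x')) ->
  forall x x', T x = T' x' -> val x = val x'.
Proof.
(* If x' were further down the common diagonal, the position of x would be a box of L' north-west of
   x', with an entry below k. By induction S has that same entry at x, where its entry is k. *)
have lower m (L L' : bipart m) (S : boxes L -> 'I_m) (S' : boxes L' ->
  'I_m) k x x' :
    standard S -> standard S' ->
    (forall z z', S z = S' z' -> (S z < k)%N -> val z = val z') ->
    S x = S' x' -> S x = k :> nat ->
    box_comp (val x) = box_comp (val x') -> box_cont (val x)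
      = box_cont (val x') ->
    ((box_pos (val x')).1 <= (box_pos (val x)).1)%N.
  move=> Sstd S'std IH Sxx Sxk exx cxx; rewrite leqNgt; apply/negP => lt1.
  have lt2 : ((box_pos (val x)).2 < (box_pos (val x')).2)%N.
    by move: cxx; rewrite /box_cont; lia.
  have [z' z'E] : exists z' : boxes L', val z' = val x.
    rewrite -(tagboxK (val x)); apply: box_ex; rewrite exx;
      apply: ltn_trans lt2 _.
    by apply: leq_trans (box_in x') (rowlen_noninc _ _ (ltnW lt1)).
  have le_z : (S' z' <= S' x')%N.
    by apply: rowlen_anti => //; rewrite z'E // ltnW.
  have nz : z' != x' by apply/eqP => zx; move: lt1; rewrite -zx z'E ltnn.
  have lt_z : (S' z' < k)%N.
    rewrite -Sxk Sxx ltn_neqAle le_z andbT val_eqE.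
    by have [S'inj _] := S'std; rewrite (inj_eq S'inj).
  have [z Sz] := standard_surj (S' z') Sstd.
  have zx : z = x by apply: val_inj; rewrite -z'E; apply: IH => //; rewrite Sz.
  by move: lt_z; rewrite -Sz zx Sxk ltnn.
move=> Tstd T'std wt.
suff main k : forall x x', T x = T' x' -> (T x < k)%N -> val x = val x'.
  by move=> x x' Txx; apply: (main (T x).+1).
elim: k => // k IH x x' Txx; rewrite ltnS leq_eqVlt => /orP[/eqP Tk|];
  last exact: IH.
have [exx cxx] := wt _ _ Txx.
have le1 := lower _ _ _ _ _ _ _ _ Tstd T'std IH Txx Tk exx cxx.
have IH' z z' : T' z = T z' -> (T' z < k)%N -> val z = val z'.
  by move=> e lt_z; apply/esym/IH; rewrite -?e.
have T'k : T' x' = k :> nat by rewrite -Txx.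
have le2 := lower _ _ _ _ _ _ _ _ T'std Tstd IH' (esym Txx) T'k (esym exx)
  (esym cxx).
rewrite -(tagboxK (val x)) -(tagboxK (val x')) exx; congr tagbox.
by move: cxx le1 le2; rewrite /box_cont;
  case: (box_pos _) (box_pos _) => [i j] [i' j'] /=;
  move=> *; congr (_, _); lia.
Qed.

(** * Counting pairs of tableaux *)

Section YoungGraph.

Local Open Scope nat_scope.

Definition incr (f : bool -> nat -> nat) (r : bool * nat) e i : nat :=
  f e i + ((e, i) == r).

Definition decr (f : bool -> nat -> nat) (r : bool * nat) e i : nat :=
  f e i - ((e, i) == r).

Definition addable (f : bool -> nat -> nat) (r : bool * nat) : bool :=
  (r.2 == 0) || (f r.1 r.2 < f r.1 r.2.-1).

Definition removable (f : bool -> nat -> nat) (r : bool * nat) : bool :=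
  f r.1 r.2.+1 < f r.1 r.2.

Section Counting.
Variable N : nat.

Definition rowpair : finType := (bool * 'I_N)%type.

Definition rowval (r : rowpair) : bool * nat := (r.1, val r.2).

Lemma rowval_inj : injective rowval.
Proof. by move=> [e i] [e' i'] [-> /val_inj ->]. Qed.

(** The coefficient of the empty pair in D^n f, where D sums over the removals of one box. The bound
    N on the rows keeps the sums finite. *)
Fixpoint npath n (f : bool -> nat -> nat) : nat :=
  if n is n'.+1 then \sum_(r : rowpair | removable f (rowval r)) npath n' (decr
    f (rowval r))
  else [forall r : rowpair, f r.1 r.2 == 0].

Lemma eq_npath n f f' : (forall e i, f e i = f' e i) -> npath n f = npath n f'.
Proof.
elim: n f f' => [|n IH] f f' ff' /=.
  by congr nat_of_bool; apply: eq_forallb => r; rewrite ff'.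
apply: eq_big => r; first by rewrite /removable !ff'.
by move=> _; apply: IH => e i; rewrite /decr ff'.
Qed.

Definition noninc (f : bool -> nat -> nat) := forall e i, f e i.+1 <= f e i.

Lemma noninc_decr f r : noninc f -> removable f r -> noninc (decr f r).
Proof.
case: r => e' i' nf; rewrite /removable /decr /= => lt_f e i; have := nf e i.
rewrite !xpair_eqE; have [->|] //= := eqVneq e e'; rewrite ?subn0 //.
by have [->|ii] := eqVneq i i'; have [E|E] := eqVneq _ i'; rewrite /=; lia.
Qed.

(** Row i + 1 is addable exactly when row i is removable, and row 0 is always addable: one surplus
    in each of the two components. Row N - 1 is empty, so no removable row loses its partner at the
    boundary. *)
Lemma card_addable f : noninc f -> (forall e i, N <= i.+1 -> f e i
    = 0) -> 0 < N ->
  #|[pred r : rowpair | addable f (rowval r)]| =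
  #|[pred r : rowpair | removable f (rowval r)]| + 2.
Proof.
move=> nf f0; move=> N_gt0.
have rowE (P : pred (bool * nat)) :
    #|[pred r : rowpair | P (rowval r)]| = \sum_e \sum_(i < N) P (e, i : nat).
  by rewrite pair_bigA -sum1_card big_mkcond; apply: eq_bigr=> r _;
    rewrite inE; case: (P _).
rewrite !rowE !big_bool /=.
have E e : \sum_(i < N) addable f (e, i : nat)
  = (\sum_(i < N) removable f (e, i : nat)).+1.
  move: N N_gt0 f0 => [//|M] _ f0.
  rewrite big_ord_recl [in RHS]big_ord_recr /= {1}/addable /= {2}/removable /=.
  rewrite (f0 e M) // ltn0 addn0 add1n; congr _.+1.
by rewrite !E addSn addnS addn2.
Qed.

Lemma decr_incr f r e i : decr (incr f r) r e i = f e i.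
Proof. by rewrite /decr /incr addnK. Qed.

Lemma incr_decr f r e i : 0 < f r.1 r.2 -> incr (decr f r) r e i = f e i.
Proof.
by rewrite /decr /incr => f0; rewrite subnK //; case: eqP f0 => // <-.
Qed.

Lemma swap_incr_decr f r r' e i : r != r' ->
  decr (incr f r) r' e i = incr (decr f r') r e i.
Proof.
move=> rr; rewrite /decr /incr.
have [E|_] := eqVneq (e, i) r; last by rewrite !addn0.
by rewrite E (negbTE rr) !subn0.
Qed.

Lemma addable_removable f r r' : noninc f -> r != r' ->
  addable f r && removable (incr f r) r'
    = removable f r' && addable (decr f r') r.
Proof.
case: r r' => [e i] [e' i'] nf;
  rewrite /addable /removable /incr /decr /= !xpair_eqE => rr.
have := nf e' i'; have := nf e i.-1.
have [ee|ne] := eqVneq e e'; last by rewrite /= !addn0 !subn0 andbC.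
move: rr; rewrite {}ee !eqxx /= => ii.
case: i ii => [|i] ii /=; first by rewrite !addn0 andbT; lia.
have [<-|ne] := eqVneq i i'; rewrite ?eqxx.
  have -> : (i == i.+1) = false by lia.
  lia.
have -> : (i'.+1 == i.+1) = false by lia.
have -> : (i' == i.+1) = false by lia.
have -> : (i.+1 == i') = false by lia.
by rewrite !addn0 !subn0 andbC.
Qed.

(** The commutator of D and U written without subtraction. Adding and removing in the same row
    returns f, once per addable row in one order and once per removable row in the other; for
    distinct rows the two orders give the same terms. *)
Lemma up_down m f : noninc f ->
  \sum_(r : rowpair | addable f (rowval r)) npath m.+1 (incr f (rowval r))
     + #|[pred r : rowpair | removable f (rowval r)]| * npath m f =
     #|[pred r : rowpair | addable f (rowval r)]| * npath m f +
     \sum_(r' : rowpair | removable f (rowval r'))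
       \sum_(r : rowpair | addable (decr f (rowval r')) (rowval r))
          npath m (incr (decr f (rowval r')) (rowval r)).
Proof.
move=> nf; pose G r r' := npath m (decr (incr f (rowval r)) (rowval r')).
have rem_incr (r : rowpair) : addable f (rowval r) ->
  removable (incr f (rowval r)) (rowval r).
  move=> _; rewrite /removable /incr eqxx xpair_eqE eqxx /=; have := nf r.1 r.2.
  have -> : (r.2.+1 == r.2 :> nat) = false by lia.
  by rewrite addn0 addn1 ltnS.
have LHSE : \sum_(r : rowpair | addable f (rowval r)) npath m.+1 (incr f
  (rowval r)) =
    #|[pred r : rowpair | addable f (rowval r)]| * npath m f +
    \sum_(r : rowpair | addable f (rowval r))
       \sum_(r' : rowpair | removable (incr f (rowval r)) (rowval r') &&
         (r' != r)) G r r'.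
  rewrite -sum_nat_const -big_split /=; apply: eq_bigr => r ar.
  rewrite (bigD1 r) ?rem_incr //=; congr (_ + _); apply: eq_npath => e i;
    exact: decr_incr.
have RHSE : \sum_(r' : rowpair | removable f (rowval r'))
       \sum_(r : rowpair | addable (decr f (rowval r')) (rowval r))
          npath m (incr (decr f (rowval r')) (rowval r)) =
    #|[pred r : rowpair | removable f (rowval r)]| * npath m f +
    \sum_(r' : rowpair | removable f (rowval r'))
       \sum_(r : rowpair | addable (decr f (rowval r')) (rowval r) &&
         (r != r')) G r r'.
  rewrite -sum_nat_const -big_split /=; apply: eq_bigr => r' rr'.
  have f_gt0 : 0 < f (rowval r').1 (rowval r').2 := leq_ltn_trans (leq0n _) rr'.
  have add_decr : addable (decr f (rowval r')) (rowval r').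
    rewrite /addable /decr eqxx; case: (rowval r') f_gt0 => e [|i] //= f_gt0.
    have -> : ((e, i) == (e, i.+1)) = false by rewrite xpair_eqE; lia.
    have := nf e i; lia.
  rewrite (bigD1 r') //=; congr (_ + _).
    by apply: eq_npath => e i; apply: incr_decr.
  apply: eq_bigr => r /andP[_ rr]; apply: eq_npath => e i.
  by rewrite swap_incr_decr // (inj_eq rowval_inj).
rewrite LHSE RHSE addnAC -addnA; congr (_ + (_ + _)).
rewrite (exchange_big_dep (fun r' => removable f (rowval r'))) /=; last first.
  move=> r r' ar /andP[rr' nrr].
  have nrr' : rowval r != rowval r' by rewrite (inj_eq rowval_inj) eq_sym.
  by have := addable_removable nf nrr'; rewrite ar rr' => /esym/andP[].
apply: eq_bigr => r' rr'; apply: eq_bigl => r.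
have [->|nrr] := eqVneq r r'; first by rewrite !andbF.
have nrr' : rowval r != rowval r' by rewrite (inj_eq rowval_inj).
by rewrite /= !andbT addable_removable // rr'.
Qed.

(** From D U = U D + 2 follows D^{n+1} U = U D^{n+1} + 2 (n+1) D^n; in the coefficient of the empty
    pair the term beginning with U disappears, since a diagram with an added box is not empty. *)
Lemma sum_addable n f : noninc f -> (forall e i, N <= i.+1 -> f e i
    = 0) -> 0 < N ->
  \sum_(r : rowpair | addable f (rowval r)) npath n.+1 (incr f (rowval r))
    = 2 * n.+1 * npath n f.
Proof.
move=> + + N_gt0; elim: n f => [|n IH] f nf f0; have := up_down _ nf;
  rewrite card_addable //.
  move/(_ 0); rewrite [X in _ = _ + X]big1 => [|r' _]; first by rewrite mulnDl;
    lia.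
  apply: big1 => r _ /=; case: forallP => // /(_ r).
  by rewrite /incr -/(rowval r) eqxx addn1.
move/(_ n.+1); have -> : \sum_(r' : rowpair | removable f (rowval r'))
     \sum_(r : rowpair | addable (decr f (rowval r')) (rowval r))
        npath n.+1 (incr (decr f (rowval r')) (rowval r))
          = 2 * n.+1 * npath n.+1 f.
  rewrite big_distrr; apply: eq_bigr => r' rr'; apply: IH;
    first exact: noninc_decr.
  by move=> e i Ni; rewrite /decr f0.
move: (npath n.+1 f) (\sum_(r | _) _) #|_| => a b c.
rewrite !mulnDl -mulnDl; nia.
Qed.

(** * Lattice words and the tableaux they encode *)

Definition cnt (p : seq rowpair) e i : nat := count (fun r => (e, i) == rowval
    r) p.

(* Lattice words, with their last letter first: each word lists the rows of the
   successive boxes of a growing pair of diagrams. *)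
Fixpoint words n : seq (seq rowpair) :=
  if n is n'.+1 then
    flatten [seq [seq r :: p | r <- enum [pred r | addable (cnt p) (rowval r)]]
      | p <- words n']
  else [:: [::]].

Lemma wordsP n p : reflect
  (exists r q, [/\ p = r :: q, q \in words n & addable (cnt q) (rowval r)])
  (p \in words n.+1).
Proof.
apply: (iffP flatten_mapP) => [[q qw /mapP[r]]|[r [q [-> qw ar]]]].
  by rewrite mem_enum inE => ar ->; exists r, q.
by exists q => //; apply/mapP; exists r; rewrite ?mem_enum.
Qed.

Lemma size_words n p : p \in words n -> size p = n.
Proof.
elim: n p => [|n IH] p; first by rewrite inE => /eqP ->.
by case/wordsP=> r [q [-> /IH /= -> _]].
Qed.

Lemma uniq_words n : uniq (words n).
Proof.
elim: n => //= n IH; apply: allpairs_uniq_dep => //.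
  by move=> p _; apply: enum_uniq.
by move=> [p r] [p' r'] _ _ /= [-> ->].
Qed.

Lemma cnt_cons r p e i : cnt (r :: p) e i = incr (cnt p) (rowval r) e i.
Proof. by rewrite /cnt /incr /= addnC. Qed.

Lemma noninc_words n p : p \in words n -> noninc (cnt p).
Proof.
elim: n p => [|n IH] p; first by rewrite inE => /eqP -> e i.
case/wordsP=> r [q [-> /IH nq ar]] e i; rewrite !cnt_cons /incr; have := nq e i.
have [E|_] := eqVneq (e, i.+1) (rowval r); last by lia.
by move: ar; rewrite /addable -E /=; lia.
Qed.

Lemma cnt_gt0 n p e i : p \in words n -> 0 < cnt p e i -> i < n.
Proof.
elim: n p i => [|n IH] p i; first by rewrite inE => /eqP ->.
case/wordsP=> r [q [-> qw ar]]; rewrite cnt_cons /incr.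
have [E|_] := eqVneq (e, i) (rowval r);
  last by rewrite addn0 => /(IH _ _ qw)/ltnW.
move=> _; move: ar; rewrite /addable -E /=; case: i {E} => //= i lt_i.
by rewrite ltnS; apply: (IH q) => //; apply: leq_ltn_trans lt_i.
Qed.

(** The coefficient of the empty pair in D^n U^n applied to it: a word is a path up, and [npath]
    counts the ways back down. *)
Lemma sum_npath n : n < N -> \sum_(p <- words n) npath n (cnt p) = 2 ^ n * n`!.
Proof.
elim: n => [|n IH] lt_nN.
  by rewrite big_seq1 /=; case: forallP => // -[].
rewrite big_flatten big_map.
transitivity (\sum_(p <- words n) 2 * n.+1 * npath n (cnt p)); last first.
  by rewrite -big_distrr /= IH ?(ltnW lt_nN) // expnS factS; ring.
apply: eq_big_seq => p pw; rewrite big_map big_enum.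
rewrite -sum_addable; first last.
- exact: leq_ltn_trans lt_nN.
- move=> e i Ni; apply/eqP; rewrite eqn0Ngt; apply/negP => /(cnt_gt0 pw); lia.
- exact: noninc_words pw.
by apply: eq_bigr => r _; apply: eq_npath => e i; apply: cnt_cons.
Qed.

Definition has_shape (f : bool -> nat -> nat) (p : seq rowpair) : bool :=
  [forall r : rowpair, cnt p r.1 r.2 == f r.1 r.2].

(** Read backwards, a path from f down to the empty pair is a lattice word of shape f; its last
    removal is the first letter written. *)
Lemma npath_le n f : noninc f -> npath n f <= count (has_shape f) (words n).
Proof.
elim: n f => [|n IH] f nf.
  rewrite /= addn0; apply: eq_leq; congr nat_of_bool.
  by apply: eq_forallb => r; rewrite eq_sym.
have cntE : count (has_shape f) (words n.+1) =
   \sum_(p <- words n) \sum_(r : rowpair | addable (cnt p) (rowval r))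
     has_shape f (r :: p).
  rewrite count_flatten -map_comp sumnE big_map; apply: eq_bigr => p _.
  by rewrite /= count_map -sum1_count big_mkcond big_enum;
    apply: eq_bigr => r _ /=; case: (has_shape _ _).
rewrite cntE /=.
apply: leq_trans (_ : \sum_(r : rowpair | removable f (rowval r)) \sum_(p <-
  words n) has_shape (decr f (rowval r)) p <= _).
  apply: leq_sum => r rr; apply: leq_trans (IH _ (noninc_decr nf rr)) _.
  by rewrite -sum1_count big_mkcond; apply: leq_sum => p _; case: (has_shape _ _).
rewrite exchange_big /=; apply: leq_sum => p _.
rewrite big_mkcond [X in _ <= X]big_mkcond; apply: leq_sum => r _.
case: ifP => // rr; case: (boolP (has_shape (decr f _) p)) => // /forallP pf.
have f_gt0 : 0 < f (rowval r).1 (rowval r).2 := leq_ltn_trans (leq0n _) rr.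
have -> : addable (cnt p) (rowval r).
  rewrite /addable; case: r rr f_gt0 pf => e [[|i] lt_i] //= rr f_gt0 pf.
  have lt_i' : i < N by apply: ltnW.
  have /eqP := pf (e, Ordinal lt_i); have /eqP := pf (e, Ordinal lt_i').
  rewrite /= /decr /rowval /= eqxx => -> ->.
  have -> : ((e, i) == (e, i.+1)) = false by rewrite xpair_eqE; lia.
  by have := nf e i; lia.
have -> // : has_shape f (r :: p).
apply/forallP => r'; rewrite cnt_cons /incr (eqP (pf r')) -/(incr (decr f
  (rowval r)) (rowval r) _ _).
by rewrite incr_decr.
Qed.

Fixpoint word_boxes (p : seq rowpair) : seq ((nat * nat) + (nat * nat)) :=
  if p is r :: q then
    tagbox r.1 (val r.2, cnt q r.1 r.2) :: word_boxes q
  else [::].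

Lemma size_word_boxes p : size (word_boxes p) = size p.
Proof. by elim: p => //= r p ->. Qed.

Lemma tagbox_comp e b : box_comp (tagbox e b) = e.
Proof. by case: e. Qed.

Lemma tagbox_pos e b : box_pos (tagbox e b) = b.
Proof. by case: e. Qed.

Lemma noninc_leq f e i i' : noninc f -> i <= i' -> f e i' <= f e i.
Proof.
move=> nf; elim: i' => [|i' IH]; first by rewrite leqn0 => /eqP ->.
rewrite leq_eqVlt => /predU1P[-> //|lt_i]; exact: leq_trans (nf e i') (IH lt_i).
Qed.

Lemma tagbox_eq e b e' b' : (tagbox e b == tagbox e' b') = (e == e') && (b == b').
Proof. by case: e e' => [] []. Qed.

Lemma mem_word_boxes p e i j : (tagbox e (i, j) \in word_boxes p)
    = (j < cnt p e i).
Proof.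
elim: p => [//|r p IH]; rewrite [word_boxes _]/= inE IH tagbox_eq cnt_cons /incr.
rewrite /rowval !xpair_eqE; have [->|] //= := eqVneq e r.1; rewrite ?addn0 //.
have [->|] //= := eqVneq i (val r.2); rewrite ?addn0 //.
by rewrite addn1 ltnS [RHS]leq_eqVlt.
Qed.

Lemma uniq_word_boxes p : uniq (word_boxes p).
Proof. by elim: p => //= r p ->; rewrite mem_word_boxes ltnn. Qed.

Lemma word_boxes_rows p :
  [seq (box_comp b, (box_pos b).1) | b <- word_boxes p] = map rowval p.
Proof. by elim: p => //= r p ->; rewrite /rowval; case: r => [[] i]. Qed.

(** The last box added comes first in the list. It was added at the end of its row, beyond the
    length of every lower row, so no earlier box lies to its right or below it. *)
Lemma index_word_boxes n p x y : p \in words n ->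
  x \in word_boxes p -> y \in word_boxes p -> bibox_lt x y ->
  index y (word_boxes p) < index x (word_boxes p).
Proof.
elim: n p => [|n IH] p; first by rewrite inE => /eqP ->.
case/wordsP=> r [q [-> qw ar]] /=; rewrite !inE.
set z := tagbox _ _.
have nlt_z t : t \in word_boxes q -> ~~ bibox_lt z t.
  rewrite -(tagboxK t); case: (box_pos t) => i j; rewrite mem_word_boxes => lt_j.
  rewrite bibox_ltE !tagbox_comp !tagbox_pos negb_and; have [e|//] := eqVneq.
  move: lt_j; rewrite -e /box_lt /= => lt_j; apply/norP; split; apply/negP.
    by case/andP=> /eqP ri; rewrite ri ltnNge ltnW.
  case/andP=> /eqP cj /ltnW ri; move: lt_j.
  by rewrite -cj ltnNge (noninc_leq _ (noninc_words qw) ri).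
have [->|nzy] /= := eqVneq y z.
  move=> xq _ lt_xz; case: (eqVneq x z) xq lt_xz => [->|nxz] //= xq.
  by rewrite bibox_ltE /box_lt !ltnn !andbF.
have [->|nzx] /= := eqVneq x z; first by move=> _ /nlt_z/negbTE ->.
by rewrite ltnS; apply: IH.
Qed.

Lemma has_shape_rowlen n (l : bipart n) p : n < N -> p \in words n ->
  has_shape (rowlen l) p -> word_boxes p =i bidiagram l.
Proof.
move=> lt_nN pw /forallP ps b; rewrite -(tagboxK b).
case: (box_pos b) => i j; rewrite mem_word_boxes mem_bidiagram /=.
congr (_ < _); have [lt_i|le_i] := ltnP i N;
  first exact/eqP/(ps (_, Ordinal lt_i)).
have lt_ni := leq_trans lt_nN le_i.
transitivity 0.
  by apply/eqP; rewrite eqn0Ngt; apply/negP => /(cnt_gt0 pw); rewrite ltnNge ltnW.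
symmetry; apply: nth_default; apply: leq_trans (ltnW lt_ni).
case: l {ps} => -[s t] /= /and3P[pS pT /eqP <-]; case: (box_comp b) => /=.
  exact: leq_trans (part_size_le pT) (leq_addl _ _).
exact: leq_trans (part_size_le pS) (leq_addr _ _).
Qed.

Lemma count_words_le n (l : bipart n) : 0 < n -> n < N ->
  count (has_shape (rowlen l)) (words n) <= nb_standard l.
Proof.
case: n l => // n l _ lt_nN.
have vx (x : boxes l) : val x \in bidiagram l := valP x.
(* The head of the list is the last box filled and must receive the largest entry, hence the
   reversal. *)
pose tab (p : seq rowpair) : {ffun boxes l -> 'I_n.+1} :=
  [ffun x => rev_ord (inord (index (val x) (word_boxes p)))].
have tabE p x : p \in words n.+1 -> has_shape (rowlen l) p ->
    tab p x = n - index (val x) (word_boxes p) :> nat /\ index (val x)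
      (word_boxes p) < n.+1.
  move=> pw pl; have lt_i : index (val x) (word_boxes p) < n.+1.
    rewrite -[X in _ < X](size_words pw) -size_word_boxes index_mem.
    by rewrite (has_shape_rowlen lt_nN pw pl) vx.
  by rewrite ffunE /= inordK // subSS.
rewrite -size_filter -(size_map tab) /nb_standard cardE.
apply: uniq_leq_size.
  rewrite map_inj_in_uniq ?filter_uniq ?uniq_words // => p q.
  rewrite !mem_filter => /andP[pl pw] /andP[ql qw] pq.
  have pb := has_shape_rowlen lt_nN pw pl;
    have qb := has_shape_rowlen lt_nN qw ql.
  suff E : word_boxes p = word_boxes q.
    by apply: (inj_map rowval_inj); rewrite -!word_boxes_rows E.
  have idx b : b \in bidiagram l -> index b (word_boxes p)
    = index b (word_boxes q).
    move=> bl; have [p1 p2] := tabE p (SeqSub bl) pw pl;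
      have [q1 q2] := tabE q (SeqSub bl) qw ql.
    by move: p1 p2 q1 q2; rewrite pq /= => ->;
      move: (index _ _) (index _ _) => u v; lia.
  have szE : size (word_boxes p) = size (word_boxes q).
    by rewrite !size_word_boxes (size_words pw) (size_words qw).
  apply: (eq_from_nth (x0 := inl (0, 0)) szE) => i lt_i.
  have bl : nth (inl (0, 0)) (word_boxes p) i \in bidiagram l by rewrite -pb
    mem_nth.
  have := idx _ bl; rewrite index_uniq ?uniq_word_boxes // => iE.
  by rewrite [in RHS]iE nth_index // qb.
move=> _ /mapP[p + ->]; rewrite mem_filter => /andP[pl pw].
have pb := has_shape_rowlen lt_nN pw pl.
rewrite mem_enum inE; apply/andP; split.
  have tinj : injective (tab p).
    move=> x y xy; have [x1 x2] := tabE p x pw pl; have [y1 y2] := tabE p y pw pl.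
    have xyi : index (val x) (word_boxes p) = index (val y) (word_boxes p).
      by move: x1 x2 y1 y2; rewrite xy; lia.
    apply: val_inj; rewrite -(nth_index (val x) (_ : val x \in word_boxes p))
      ?pb ?vx //.
    by rewrite xyi nth_index // pb vx.
  apply/forallP=> k; have cX : #|'I_n.+1| <= #|{: boxes l}| by rewrite
    card_boxes card_ord.
  have /codomP[x ->] := inj_card_onto tinj cX k.
  by apply/cards1P; exists x; apply/setP=> y; rewrite !inE (inj_eq tinj).
apply/forallP=> x; apply/forallP=> y; apply/implyP => lt_xy.
have [x1 x2] := tabE p x pw pl; have [y1 y2] := tabE p y pw pl.
have := index_word_boxes pw (_ : val x \in _) (_ : val y \in _) lt_xy.
by rewrite !pb !vx => /(_ isT isT); rewrite x1 y1; move: x2 y2;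
  move: (index _ _) (index _ _) => u v; lia.
Qed.

Lemma nth_filter_neq0 s i : sorted geq s -> nth 0 [seq x <- s | x != 0] i
    = nth 0 s i.
Proof.
elim: s i => //= x s IH i ss; have [x0|nx] := eqVneq x 0.
  have s0 : all (pred1 0) s.
    move: ss; rewrite x0 (path_sortedE (leT := geq));
      last by move=> a b c /= ba cb; exact: leq_trans cb ba.
    by case/andP=> /allP H _; apply/allP=> y /H; rewrite /= leqn0.
  have -> : [seq y <- s | y != 0] = [::].
    by apply/eqP; rewrite -size_eq0 size_filter -leqn0 leqNgt -has_count
      -all_predC; apply/allP=> y /(allP s0) /= /eqP ->.
  rewrite nth_nil; case: i => //= i.
  have [lt_i|/(nth_default 0) //] := ltnP i (size s).
  by have /eqP := allP s0 _ (mem_nth 0 lt_i).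
by case: i => //= i; apply/IH/(path_sorted ss).
Qed.

Lemma sumn_filter_neq0 s : sumn [seq x <- s | x != 0] = sumn s.
Proof. by elim: s => //= x s IH; case: eqP => [->|_] /=; rewrite IH. Qed.

Lemma sum_cnt p : \sum_e \sum_(i < N) cnt p e i = size p.
Proof.
rewrite pair_bigA /=; elim: p => [|r p IH]; first by apply: big1.
under eq_bigr do rewrite cnt_cons /incr.
rewrite big_split /= IH (bigD1 r) //= big1 ?eqxx ?addn0 ?addn1 // => q qr.
by rewrite -[(q.1, _)]/(rowval q) (inj_eq rowval_inj) (negbTE qr).
Qed.

Lemma words_shape n p : p \in words n ->
    exists l : bipart n, has_shape (rowlen l) p.
Proof.
move=> pw; pose rows e := mkseq (cnt p e) N;
  pose s e := [seq x <- rows e | x != 0].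
have rows_sorted e : sorted geq (rows e).
  apply/(sortedP 0) => i; rewrite size_mkseq => lt_i.
  by rewrite !nth_mkseq ?(ltnW lt_i) //; apply: (noninc_words pw e i).
have ps e : is_part (s e).
  rewrite /is_part mem_filter eqxx andbT; apply: sorted_filter => //.
  by move=> a b c /= ba cb; exact: leq_trans cb ba.
have sl : is_bipart n (s false, s true).
  have rowsE e : sumn (rows e) = \sum_(i < N) cnt p e i.
    by rewrite sumnE big_map -[X in iota _ X]subn0 big_mkord.
  have := sum_cnt p; rewrite big_bool (size_words pw) /= addnC => sum_n.
  by rewrite /is_bipart !ps /= !sumn_filter_neq0 !rowsE sum_n.
exists (Bipart sl); apply/forallP=> -[e i];
  rewrite /rowlen /= (_ : nth _ _ _ = nth 0 (s e) i); last by case: e.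
by rewrite nth_filter_neq0 // nth_mkseq.
Qed.

End Counting.

(** Group the words by shape: a shape l has at most [nb_standard l] words, and from each of them at
    most [nb_standard l] paths lead down. *)
Lemma sum_nb_standard_ge n : 0 < n ->
    2 ^ n * n`! <= \sum_(l : bipart n) nb_standard l ^ 2.
Proof.
move=> n_gt0; rewrite -(@sum_npath n.+1 n) //.
apply: leq_trans (_ : \sum_(p <- words n.+1 n) \sum_(l : bipart n | has_shape
  (rowlen l) p) nb_standard l <= _).
  rewrite big_seq [X in _ <= X]big_seq; apply: leq_sum => p pw.
  have [l pl] := words_shape pw.
  rewrite (bigD1 l) //=; apply: leq_trans (leq_addr _ _).
  have eq_shape e i : cnt p e i = rowlen l e i.
    have E j : (j < cnt p e i) = (j < rowlen l e i).
      by rewrite -mem_word_boxes -(mem_bidiagram l e (i, j)) (has_shape_rowlen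
        _ pw pl).
    apply/eqP; rewrite eqn_leq; apply/andP; split; rewrite leqNgt; apply/negP.
      by rewrite E ltnn.
    by rewrite -E ltnn.
  rewrite (eq_npath _ _ eq_shape);
    apply: leq_trans (count_words_le l n_gt0 (ltnSn n)).
  by apply: npath_le => e i; apply: rowlen_noninc.
rewrite (exchange_big_dep predT) //=; apply: leq_sum => l _.
rewrite big_const_seq iter_addn_0 -mulnn leq_mul2l.
by rewrite count_words_le ?orbT.
Qed.

End YoungGraph.

(** * The eigenbasis *)

(** To isolate F j, apply for each other i an operator minus its eigenvalue on F i, chosen to
    separate i from j: F i is killed and F j is only rescaled by a nonzero factor. The operators
    enter solely through [stable], their effect on linear relations. *)
Lemma joint_eigen_free (R : fieldType) (G : Type) (I : finType) (K : Type)
    (F : I -> G -> R) (a : I -> K -> R) (c : I -> R) :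
    (forall i, exists g, F i g != 0) ->
    (forall k w, (forall g, \sum_i w i * F i g = 0) ->
       forall g, \sum_i w i * a i k * F i g = 0) ->
    (forall i j, i != j -> exists k, a i k != a j k) ->
  (forall g, \sum_i c i * F i g = 0) -> forall i, c i = 0.
Proof.
move=> F0 stable sep cF0 j.
have [b [bj b0 bF]] : exists b : I -> R,
    [/\ b j != 0, {in enum (predC1 j), forall i, b i = 0} &
        forall g, \sum_i c i * b i * F i g = 0].
  have: j \notin enum (predC1 j) by rewrite mem_enum !inE eqxx.
  elim: (enum _) => [_|i s IH].
    exists (fun=> 1); split=> [||g]; rewrite ?oner_eq0 //.
    by under eq_bigr do rewrite mulr1.
  rewrite inE negb_or => /andP[ji /IH[b [bj b0 bF]]].
  have [k ak] := sep _ _ ji.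
  exists (fun x => b x * (a x k - a i k)); split=> [|x|g].
  - by rewrite mulf_neq0 // subr_eq0.
  - by rewrite inE => /predU1P[->|/b0 ->]; rewrite ?subrr ?mulr0 ?mul0r.
  transitivity (\sum_x c x * b x * a x k * F x g - a i k * \sum_x c x * b x * F
    x g).
    by rewrite mulr_sumr -sumrB; apply: eq_bigr=> x _; ring.
  by rewrite bF mulr0 subr0; apply: stable.
have [g Fg] := F0 j.
have := bF g; rewrite (bigD1 j) //= big1 => [|i ij]; last first.
  by rewrite b0 ?mulr0 ?mul0r // mem_enum inE.
by move/eqP; rewrite addr0 !mulf_eq0 (negbTE Fg) (negbTE bj) !orbF => /eqP.
Qed.

(** * The step distribution as a sum of indicators *)

Section RTsupport.
Variables (R : numFieldType) (n : nat).

Definition sgntransp (c : bool) (i j : 'I_n) : {perm signed n} :=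
  if c then (stransp i j * sflip j * sflip i)%g else stransp i j.

Lemma sgntranspE c (i j : 'I_n) p : i != j ->
  sgntransp c i j (p, false) = (tperm i j p, c && ((p == i) || (p == j))).
Proof.
move=> ij; case: c => /=; last by rewrite stranspE.
rewrite 2!permM stranspE !sflipE /=.
have nij := negbTE ij; have nji : (j == i) = false by rewrite eq_sym.
case: tpermP => [->|->|/eqP/negbTE pi /eqP/negbTE pj];
  by rewrite ?eqxx ?nij ?nji ?pi ?pj ?orbT.
Qed.

Lemma sgntransp_hyperoct c (i j : 'I_n) : sgntransp c i j \in hyperoct n.
Proof.
case: c; rewrite /sgntransp ?stransp_hyperoct //.
have sjG := sflip_hyperoct j; have siG := sflip_hyperoct i.
by have := groupM (groupM (stransp_hyperoct i j) sjG) siG.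
Qed.

Lemma sgntransp_inj c d (i j i' j' : 'I_n) : (i < j)%N -> (i' < j')%N ->
  (sgntransp c i j == sgntransp d i' j') = [&& c == d, i == i' & j == j'].
Proof.
move=> ij ij'; apply/eqP/and3P => [E|[/eqP-> /eqP-> /eqP->] //].
have nij : i != j by rewrite -val_eqE neq_ltn ij.
have nij' : i' != j' by rewrite -val_eqE neq_ltn ij'.
have := congr1 (fun s : {perm signed n} => s (i, false)) E.
rewrite !sgntranspE // eqxx andbT tpermL => -[].
case: tpermP => [-> -> -> | ij2 ji _ | _ _ ji _].
- by rewrite !eqxx andbT.
- by move: ij ij'; rewrite ji ij2; lia.
- by rewrite ji eqxx in nij.
Qed.

Lemma sgntransp_neq_sflip c (i j k : 'I_n) : (i < j)%N ->
    sgntransp c i j != sflip k.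
Proof.
move=> ij; have nij : i != j by rewrite -val_eqE neq_ltn ij.
apply/eqP => /(congr1 (fun s : {perm signed n} => s (i, false))).
by rewrite sgntranspE // sflipE tpermL => -[/esym/eqP]; rewrite (negbTE nij).
Qed.

Lemma sgntransp_neq1 c (i j : 'I_n) : (i < j)%N -> sgntransp c i j != 1%g.
Proof.
move=> ij; have nij : i != j by rewrite -val_eqE neq_ltn ij.
apply/eqP => /(congr1 (fun s : {perm signed n} => s (i, false))).
by rewrite sgntranspE // perm1 tpermL => -[/esym/eqP]; rewrite (negbTE nij).
Qed.

Lemma sflip_neq1 (i : 'I_n) : sflip i != 1%g.
Proof.
apply/eqP => /(congr1 (fun s : {perm signed n} => s (i, false))).
by rewrite sflipE perm1 /= eqxx.
Qed.

Lemma sflip_inj : injective (@sflip n).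
Proof.
move=> i j /(congr1 (fun s : {perm signed n} => s (i, false))).
by rewrite !sflipE eqxx /= => -[]; case: eqP.
Qed.

(** The nested tests become a sum because the identity, the sign changes and the two kinds of
    transpositions with i < j are pairwise distinct. *)
Lemma RTE (s : {perm signed n}) : RT R s =
  (s == 1%g)%:R * (2 * n%:R)^-1 +
  (\sum_i (s == sflip i)%:R * (2 * n%:R ^+ 2)^-1 +
   \sum_(j < n) \sum_(i < n | (i < j)%N) \sum_c (s == sgntransp c i j)%:R *
     (n%:R ^+ 2)^-1).
Proof.
rewrite /RT; have [->|s1] := eqVneq s 1%g.
  rewrite mul1r !big1 ?addr0 // => [j _|i _].
    by rewrite big1 // => i ij; rewrite big1 // => c _;
      rewrite eq_sym (negbTE (sgntransp_neq1 _ ij)) mul0r.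
  by rewrite eq_sym (negbTE (sflip_neq1 _)) mul0r.
rewrite mul0r add0r; case: existsP => [[k /eqP sk]|nfl].
  rewrite [X in _ + X]big1 => [|j _]; last first.
    by rewrite big1 // => i ij; rewrite big1 // => c _;
      rewrite sk eq_sym (negbTE (sgntransp_neq_sflip _ _ ij)) mul0r.
  rewrite (bigD1 k) //= sk eqxx mul1r big1 ?addr0 // => i ik.
  by rewrite (inj_eq sflip_inj) eq_sym (negbTE ik) mul0r.
rewrite [X in X + _]big1 ?add0r => [|i _]; last first.
  by case: eqP => [si|]; rewrite ?mul0r //; case: nfl; exists i; apply/eqP.
have sE i j : (s == stransp i j) || (s == stransp i j * sflip j * sflip i)%g
    = [exists c, s == sgntransp c i j].
  apply/orP/existsP=> [[H|H]|[[] H]];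
    [by exists false|by exists true|by right|by left].
case: existsP => [[i /existsP[j /andP[ij]]]|nst].
  rewrite sE => /existsP[c /eqP ->].
  rewrite (bigD1 j) //= (bigD1 i) //= (bigD1 c) //= eqxx mul1r.
  rewrite !big1 ?addr0 // => [j' jj|i' /andP[ij' ii]|c' cc].
  - rewrite big1 // => i' ij'; rewrite big1 // => c' _.
    by rewrite sgntransp_inj // [j == _]eq_sym (negbTE jj) !andbF mul0r.
  - by rewrite big1 // => c' _;
      rewrite sgntransp_inj // [i == _]eq_sym (negbTE ii) !andbF mul0r.
  by rewrite sgntransp_inj // eq_sym (negbTE cc) mul0r.
rewrite big1 // => j _; rewrite big1 // => i ij; rewrite big1 // => c _.
case: eqP => [sc|]; rewrite ?mul0r //; case: nst; exists i; apply/existsP;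
  exists j.
by rewrite ij sE; apply/existsP; exists c; apply/eqP.
Qed.

Lemma sum_RT (F : {perm signed n} -> R) :
  \sum_(s in hyperoct n) RT R s * F s =
  (2 * n%:R)^-1 * F 1%g + ((2 * n%:R ^+ 2)^-1 * \sum_i F (sflip i) +
  (n%:R ^+ 2)^-1 * \sum_(j < n) \sum_(i < n | (i < j)%N) \sum_c F (sgntransp c
    i j)).
Proof.
have pick t (w : R) : t \in hyperoct n ->
  \sum_(s in hyperoct n) (s == t)%:R * w * F s = w * F t.
  move=> tG; rewrite (bigD1 t) //= eqxx mul1r big1 ?addr0 // => s /andP[_ st].
  by rewrite (negbTE st) !mul0r.
under eq_bigr => s _ do rewrite RTE mulrDl [X in _ + X]mulrDl.
rewrite !big_split /= pick ?group1 //; congr (_ + (_ + _)).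
  under eq_bigr do rewrite mulr_suml.
  by rewrite exchange_big mulr_sumr; apply: eq_bigr=> i _;
    rewrite pick ?sflip_hyperoct.
under eq_bigr => s _.
  rewrite mulr_suml; under eq_bigr => j _.
    rewrite mulr_suml; under eq_bigr => i _ do rewrite mulr_suml.
    over.
  over.
rewrite exchange_big mulr_sumr; apply: eq_bigr => j _.
rewrite exchange_big mulr_sumr; apply: eq_bigr => i _.
rewrite exchange_big mulr_sumr; apply: eq_bigr => c _.
by rewrite pick ?sgntransp_hyperoct.
Qed.

End RTsupport.

(** * The eigenvalue of a weight function *)

Section Eigen.
Variables (R : numFieldType) (n : nat) (l : bipart n).
Let X : finType := boxes l.
Let eps (x : X) := box_comp (val x).
Let cont (x : X) := box_cont (val x).

Lemma jm_full (T : X -> 'I_n) (F : {perm signed n} -> R) g x :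
  standard T -> rweight eps cont T F ->
  \sum_(i < n | (i < T x)%N) \sum_c F (g * sgntransp c i (T x))%g
    = 2 * (cont x)%:~R * F g.
Proof.
move=> Tstd [w1 w2]; have [Tinj _] := Tstd.
have Tbij : bijective T by apply: inj_card_bij => //; rewrite card_boxes card_ord.
rewrite (reindex T) /=; last exact: onW_bij.
rewrite -mulrA -w2 mulr_sumr [in RHS]big_mkcondr /=; apply: eq_bigr=> y _.
rewrite big_bool /= !mulgA !w1.
by case: (eps y) (eps x) => [] [] /=; ring.
Qed.

Lemma sum_boxes (f : (nat * nat) + (nat * nat) -> R) :
  \sum_(x : X) f (val x) = \sum_(b <- bidiagram l) f b.
Proof.
Proof.
rewrite -(big_map val predT f); apply: perm_big; apply: uniq_perm.
- by rewrite (map_inj_uniq val_inj) index_enum_uniq.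
- exact: uniq_bidiagram.
move=> b; apply/mapP/idP => [[x _ ->]|bl]; first exact: valP.
by exists (SeqSub bl); rewrite ?mem_index_enum.
Qed.

Lemma sum_sign_boxes : \sum_x (1 + (-1) ^+ eps x) = 2 * (sumn l.1)%:R :> R.
Proof.
rewrite (sum_boxes (fun b => 1 + (-1) ^+ box_comp b)) big_cat !big_map /=.
rewrite [X in _ + X]big1 => [|b _]; last by rewrite expr1 subrr.
rewrite addr0 expr0 big_const_seq count_predT iter_addr_0 size_diagram.
by rewrite -mulr_natr; ring.
Qed.

Lemma sum_cont_boxes : \sum_x (cont x)%:~R = (Diag l.1)%:~R + (Diag l.2)%:~R :> R.
Proof.
rewrite (sum_boxes (fun b => (box_cont b)%:~R)) big_cat !big_map /=.
by rewrite !rmorph_sum.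
Qed.

Lemma RT_eigen (T : X -> 'I_n) (F : {perm signed n} -> R) g :
  (0 < n)%N -> standard T -> rweight eps cont T F ->
  \sum_(s in hyperoct n) RT R s * F (g * s)%g = eig R l * F g.
Proof.
move=> n_gt0 Tstd wT; have [Tinj _] := Tstd; have [w1 w2] := wT.
have Tbij : bijective T by apply: inj_card_bij => //; rewrite card_boxes card_ord.
have n0 : n%:R != 0 :> R by rewrite pnatr_eq0 -lt0n.
rewrite (sum_RT (fun s => F (g * s)%g)) mulg1.
rewrite (reindex T) /=; last exact: onW_bij.
rewrite [X in _ + (_ + _ * X)](reindex T) /=; last exact: onW_bij.
rewrite (eq_bigr _ (fun x _ => w1 g x)) -mulr_suml.
rewrite (eq_bigr _ (fun x _ => jm_full g x Tstd wT)) -mulr_suml -mulr_sumr.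
rewrite sum_cont_boxes.
(* The term - n cancels the mass 1/(2n) = n/(2n^2) of the identity, which leaves the 2 |lambda^1| of
   the formula. *)
have -> : \sum_x (-1) ^+ eps x = 2 * (sumn l.1)%:R - n%:R :> R.
  by rewrite -sum_sign_boxes big_split /= sumr_const card_boxes addrAC subrr
    add0r.
by rewrite /eig; field.
Qed.

(* [c] selects the operator: the sign change of [k] if true, J_k if false. *)
Definition entry_weight (T : X -> 'I_n) (k : 'I_n) (c : bool) : R :=
  if [pick x | T x == k] is Some x then
    (if c then (-1) ^+ eps x else 2 * (cont x)%:~R)
  else 0.

Lemma entry_weightE T x c : injective T ->
  entry_weight T (T x) c = if c then (-1) ^+ eps x else 2 * (cont x)%:~R.
Proof.
rewrite /entry_weight => Tinj; case: pickP => [y /eqP/Tinj -> //|/(_ x)].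
by rewrite eqxx.
Qed.

End Eigen.

Definition entry_op (R : numFieldType) n (F : {perm signed n} ->
    R) (k : 'I_n) (c : bool)
    (g : {perm signed n}) : R :=
  if c then F (g * sflip k)%g
  else \sum_(i < n | (i < k)%N) \sum_d F (g * sgntransp d i k)%g.

Lemma entry_op_sum (R : numFieldType) n (I : finType) (w : I -> R)
    (F : I -> {perm signed n} -> R) k c g :
  entry_op (fun g => \sum_i w i * F i g) k c g
    = \sum_i w i * entry_op (F i) k c g.
Proof.
rewrite /entry_op; case: c => //.
under eq_bigr do rewrite exchange_big.
rewrite exchange_big /=; apply: eq_bigr => i _; rewrite mulr_sumr.
by apply: eq_bigr => j _; rewrite mulr_sumr.
Qed.

Lemma entry_opE (R : numFieldType) n (l : bipart n) (T : boxes l -> 'I_n)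
    (F : {perm signed n} -> R) k c g : standard T ->
  rweight (fun x => box_comp (val x)) (fun x => box_cont (val x)) T F ->
  entry_op F k c g = entry_weight R T k c * F g.
Proof.
move=> Tstd wT; have [x <-] := standard_surj k Tstd; have [Tinj _] := Tstd.
rewrite entry_weightE //; case: c; rewrite /entry_op.
  by case: wT.
exact: jm_full.
Qed.

Lemma entry_weight_inj (R : numFieldType) n (l l' : bipart n)
    (T : boxes l -> 'I_n) (T' : boxes l' -> 'I_n) :
    standard T -> standard T' ->
    (forall k c, entry_weight R T k c = entry_weight R T' k c) ->
  forall x x', T x = T' x' -> val x = val x'.
Proof.
move=> Tstd T'std wtE; apply: standard_determined => // x x' Txx.
have [Tinj _] := Tstd; have [T'inj _] := T'std.
have := wtE (T x) true; have := wtE (T x) false.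
rewrite {2 4}Txx !entry_weightE //.
move=> cE /signr_inj eE; split=> //.
apply: (@intr_inj R); apply: (mulfI _ cE); by rewrite pnatr_eq0.
Qed.

Definition standard_tab n (l : bipart n) : finType :=
  {T : {ffun boxes l -> 'I_n} | is_standard T}.

Lemma is_standardP n (l : bipart n) (T : {ffun boxes l -> 'I_n}) :
  reflect (standard T) (is_standard T).
Proof.
have cX := card_boxes l.
apply: (iffP andP) => -[].
  move=> /forallP T1 /forallP Tlt; split.
    move=> x y xy; have /cards1P[z zE] := T1 (T x).
    have : x \in [set z] by rewrite -zE inE.
    have : y \in [set z] by rewrite -zE inE xy.
    by rewrite !inE => /eqP -> /eqP ->.
  by move=> x y; move: (Tlt x) => /forallP/(_ y)/implyP.
move=> Tinj Tlt; split.
  apply/forallP=> k; have [x <-] := @standard_surj _ _ T k (conj Tinj Tlt).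
  by apply/cards1P; exists x; apply/setP=> y; rewrite !inE (inj_eq Tinj).
by apply/forallP=> x; apply/forallP=> y; apply/implyP; apply: Tlt.
Qed.

Lemma standard_tabP n (l : bipart n) (T : standard_tab l) : standard (val T).
Proof. exact/is_standardP/valP. Qed.

Definition tab_pair n : finType :=
  {l : bipart n & (standard_tab l * standard_tab l)%type}.

Definition left_tab n (i : tab_pair n) : boxes (tag i) ->
    'I_n := val (tagged i).1.

Definition right_tab n (i : tab_pair n) : boxes (tag i) ->
    'I_n := val (tagged i).2.

Arguments left_tab {n} i _.
Arguments right_tab {n} i _.

Lemma left_tabP n (i : tab_pair n) : standard (left_tab i).
Proof. exact: standard_tabP. Qed.

Lemma right_tabP n (i : tab_pair n) : standard (right_tab i).
Proof. exact: standard_tabP. Qed.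

Lemma card_standard_tab n (l : bipart n) : #|standard_tab l| = nb_standard l.
Proof. by rewrite card_sig /nb_standard cardsE. Qed.

Lemma card_tab_pair n : #|tab_pair n| = (\sum_(l : bipart n) nb_standard l ^ 2)%N.
Proof.
rewrite card_tagged sumnE big_map big_enum; apply: eq_bigr=> l _.
by rewrite card_prod card_standard_tab mulnn.
Qed.

(** * Independence of the two-sided weight functions *)

Section Basis.
Variables (R : numFieldType) (n : nat).

Definition pair_weight (i : tab_pair n) (p : bool * 'I_n * bool) : R :=
  let: (s, k, c) := p in
  entry_weight R (if s then left_tab i else right_tab i) k c.

Lemma pair_weight_inj (i j : tab_pair n) :
  pair_weight i =1 pair_weight j -> i = j.
Proof.
case: i j => [l [S T]] [l' [S' T']] wE.
have Sstd := standard_tabP S; have Tstd := standard_tabP T.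
have S'std := standard_tabP S'; have T'std := standard_tabP T'.
have SE := entry_weight_inj Sstd S'std (fun k c => wE (true, k, c)).
have TE := entry_weight_inj Tstd T'std (fun k c => wE (false, k, c)).
have ll' : l = l'.
  apply: bipart_inj => b; apply/idP/idP => bl.
    have [x' xx] := standard_surj (val T (SeqSub bl)) T'std.
    by have /= -> := TE (SeqSub bl) x' (esym xx); apply: valP.
  have [x xx] := standard_surj (val T' (SeqSub bl)) Tstd.
  by have /= <- := TE x (SeqSub bl) xx; apply: valP.
subst l'.
have eqT (U U' : standard_tab l) :
    (forall x x', val U x = val U' x' -> val x = val x') -> U = U'.
  move=> UU; apply/val_inj/ffunP=> x.
  have [x' xx] := standard_surj (val U x) (standard_tabP U').
  by rewrite -xx; congr (val U' _); apply/val_inj/esym/UU.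
by rewrite (eqT _ _ SE) (eqT _ _ TE).
Qed.

Lemma biweight_basis : exists F : tab_pair n -> {perm signed n} -> R,
  forall i, biweight (fun x => box_comp (val x)) (fun x => box_cont (val x))
     (left_tab i) (right_tab i) (F i).
Proof.
have wF i : exists F : {perm signed n} -> R,
    biweight (fun x => box_comp (val x)) (fun x => box_cont (val x))
      (left_tab i) (right_tab i) F.
  by apply: biweight_ofP; [apply: left_tabP|apply: right_tabP].
exact: (fin_all_exists wF).
Qed.

(** An arbitrary injective family serves twice: the family of all pairs gives the bound on their
    number, and one indexed by B_n gives an invertible square matrix. *)
Lemma biweight_free (F : tab_pair n -> {perm signed n} -> R) m (e : 'I_m ->
    tab_pair n) :
    (forall i, biweight (fun x => box_comp (val x)) (fun x => box_cont (val x))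
     (left_tab i) (right_tab i) (F i)) ->
    injective e ->
  row_free (\matrix_(b < m, a < #|hyperoct n|) F (e b) (enum_val a)).
Proof.
move=> wF einj; apply: inj_row_free => v v0; apply/rowP=> b; rewrite mxE.
apply: (@joint_eigen_free R _ _ _ (fun b => F (e b)) (fun b => pair_weight (e
  b)) (v 0)).
- by move=> i; case: (wF (e i)).
- move=> [[s k] c] w wF0 g.
  case: s.
    (* Left operators are right operators after inversion of the argument, and a relation valid at
       all g is valid at all inverses. *)
    transitivity (entry_op (fun g => \sum_i w i * F (e i) g^-1%g) k c g^-1%g).
      rewrite entry_op_sum; apply: eq_bigr => i _.
      have [_ _ wS _] := wF (e i).
      by rewrite (entry_opE _ _ _ (left_tabP _) wS) invgK mulrA.
    by rewrite /entry_op; case: c; rewrite ?wF0 // big1 // => j _; rewrite big1.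
  transitivity (entry_op (fun g => \sum_i w i * F (e i) g) k c g).
    rewrite entry_op_sum; apply: eq_bigr => i _.
    have [_ _ _ wT] := wF (e i).
    by rewrite (entry_opE _ _ _ (right_tabP _) wT) mulrA.
  by rewrite /entry_op; case: c; rewrite ?wF0 // big1 // => j _; rewrite big1.
- move=> i j ij.
  have [/forallP wE|/forallPn[p]] := boolP [forall p, pair_weight (e i) p ==
    pair_weight (e j) p].
    by move: ij; rewrite (einj _ _ (pair_weight_inj (fun p => eqP (wE p)))) eqxx.
  by exists p.
(* The matrix records values on B_n only; off B_n every F vanishes, so the relation extends to all
   permutations. *)
move=> g; have [gG|gG] := boolP (g \in hyperoct n); last first.
  by rewrite big1 // => i _; have [-> //] := wF (e i); rewrite mulr0.
have := congr1 (fun u : 'rV_(#|hyperoct n|) => u 0 (enum_rank_in gG g)) v0.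
rewrite mxE [RHS]mxE => vg; rewrite -[RHS]vg; apply: eq_bigr=> i _.
by rewrite mxE enum_rankK_in.
Qed.

Lemma card_tab_pair_le : (#|tab_pair n| <= #|hyperoct n|)%N.
Proof.
have [F wF] := biweight_basis.
have := biweight_free wF (@enum_val_inj _ (mem (tab_pair n))).
by rewrite -row_leq_rank => /leq_trans; apply; apply: rank_leq_col.
Qed.

End Basis.

Lemma card_hyperoct_le n : (#|hyperoct n| <= 2 ^ n * n`!)%N.
Proof.
pose f (s : {perm signed n}) : {ffun 'I_n -> 'I_n} * {ffun 'I_n -> bool} :=
  ([ffun i => (s (i, false)).1], [ffun i => (s (i, false)).2]).
have finj : {in hyperoct n &, injective f}.
  move=> s t sG tG [/ffunP st1 /ffunP st2]; apply/permP.
  have st i : s (i, false) = t (i, false).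
    by have := st1 i; have := st2 i; rewrite !ffunE;
      case: (s _) (t _) => [a b] [c d] /= -> ->.
  move=> [i []]; last exact: st.
  by rewrite -[(i, true)]/(sopp (i, false)) !hyperoct_sopp // st.
rewrite -(card_in_imset finj).
have sub : f @: hyperoct n \subset setX [set g : {ffun 'I_n ->
  'I_n} | injectiveb g] setT.
  apply/subsetP=> _ /imsetP[s sG ->]; rewrite !inE andbT; apply/injectiveP=> i j.
  rewrite !ffunE => ij; have [/perm_inj [] //|ne] := eqVneq (s (i, false)) (s
    (j, false)).
  have : s (i, false) = s (sopp (j, false)).
    rewrite hyperoct_sopp //; move: ij ne;
      case: (s _) (s _) => [a b] [c d] /= -> /=.
    by rewrite /sopp /= xpair_eqE eqxx /=; case: b d => [] [].
  by move/perm_inj => [].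
apply: leq_trans (subset_leq_card sub) _.
by rewrite cardsX cardsT card_ffun card_bool card_inj_ffuns !card_ord ffactnn
  mulnC.
Qed.

Lemma char_poly_eigenbasis (R : fieldType) N (M P : 'M[R]_N) (d : 'rV_N) :
  P \in unitmx -> M *m P = P *m diag_mx d ->
  char_poly M = \prod_i ('X - (d 0 i)%:P).
Proof.
move=> uP MP; have : char_poly_mx M *m map_mx polyC P
  = map_mx polyC P *m char_poly_mx (diag_mx d).
  rewrite /char_poly_mx mulmxBl mulmxBr -!map_mxM MP; congr (_ - _).
  by rewrite mul_scalar_mx mul_mx_scalar.
move/(congr1 determinant); rewrite !det_mulmx det_map_mx [RHS]mulrC.
have detP0 : (\det P)%:P != 0 by rewrite polyC_eq0 -unitfE -unitmxE.
move/(mulIf detP0); rewrite -/(char_poly M) -/(char_poly _) => ->.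
rewrite char_poly_trig ?diag_mx_is_trig //; apply: eq_bigr=> i _.
by rewrite mxE eqxx.
Qed.

Theorem theorem4p3p2 (R : numFieldType) (n : nat) (hn : (0 < n)%N) :
  char_poly (RTmx R n) =
    \prod_(l : bipart n) ('X - (eig R l)%:P) ^+ (nb_standard l ^ 2)%N.
Proof.
have cardE : #|hyperoct n| = #|tab_pair n|.
  apply/eqP; rewrite eqn_leq (card_tab_pair_le R) andbT card_tab_pair.
  exact: leq_trans (card_hyperoct_le n) (sum_nb_standard_ge hn).
pose e (b : 'I_#|hyperoct n|) : tab_pair n := enum_val (cast_ord cardE b).
have einj : injective e by move=> b c /enum_val_inj/cast_ord_inj.
have [F wF] := biweight_basis R n.
(* Transposed so that the columns are the eigenvectors. *)
pose P : 'M[R]_#|hyperoct n| := (\matrix_(b, a) F (e b) (enum_val a))^T.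
have uP : P \in unitmx by rewrite unitmx_tr -row_free_unit biweight_free.
rewrite (char_poly_eigenbasis (d := \row_b eig R (tag (e b))) uP).
  transitivity (\prod_(i : tab_pair n) ('X - (eig R (tag i))%:P)).
    rewrite [RHS](reindex e) /=; last first.
      by apply: onW_bij; apply: inj_card_bij => //; rewrite card_ord cardE.
    by apply: eq_bigr=> b _; rewrite mxE.
  transitivity (\prod_(l : bipart n) \prod_(p : standard_tab l * standard_tab
    l) ('X - (eig R l)%:P)).
    by rewrite sig_big_dep.
  by apply: eq_bigr=> l _; rewrite prodr_const card_prod card_standard_tab mulnn.
apply/matrixP=> a b; rewrite mul_mx_diag !mxE.
have [_ _ _ wT] := wF (e b).
rewrite mulrC -(RT_eigen _ hn (right_tabP _) wT).
have aG := enum_valP a.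
(* Substituting s = g^-1 h turns the sum over steps s from g into a row of [RTmx]. *)
rewrite (reindex_inj (mulgI (enum_val a)^-1%g)) /=.
rewrite [RHS](eq_bigl (fun g => g \in hyperoct n)); last by move=> g;
  rewrite groupMl ?groupV.
rewrite [RHS](reindex_onto (@enum_val _ (mem (hyperoct n))) (enum_rank_in aG));
  last first.
  by move=> g gG; rewrite enum_rankK_in.
apply: eq_big => c; first by rewrite enum_valP enum_valK_in eqxx.
by move=> _; rewrite !mxE mulKVg.
Qed.
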